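(* Let $F$ be a forest with no vertex of degree $3$. Then $\chi_{\mathrm{g}}(F)<4$ if and only if there exists a vertex $a$ of $F$ such that, once $a$ becomes colored, every trunk $R'$ of the reduced graph $\mathcal{R}'(F)$ satisfies one of: (i) $R'$ has exactly one colored vertex and contains no edge of $E_{>>2}(\mathcal{R}'(F))$; or (ii) $R'$ has no colored vertices and there exists a vertex $v\in V(R')$ that covers $E_{>>2}(R')$.
   Context: $\chi_{\mathrm{g}}(G)$ is the least $t$ such that Alice has a winning strategy in the $t$-coloring game on $G$: Alice and Bob alternate turns, Alice first, coloring uncolored vertices with colors from a $t$-set so that no vertex gets a color used on a neighbor; Bob wins if some uncolored vertex has no available color, Alice wins if all vertices get colored. For a partially colored forest $F$, a trunk of $F$ is a maximal connected subgraph $R$ such that every colored vertex of $R$ is a leaf of $R$; $\mathcal{R}(F)$ is the partially colored forest formed by the disjoint union of all trunks of $F$ (a colored vertex lying in several trunks appears as a separate colored copy in each). For a graph $G$, $E_{>2}(G)$ is the set of edges $xy$ with $d_G(x)>2$ or $d_G(y)>2$, and $E_{>>2}(G)$ the set of edges $xy$ with $d_G(x)>2$ and $d_G(y)>2$. The reduced graph is $\mathcal{R}'(F)=\mathcal{R}(F)-\{xy: xy\notin E_{>2}(\mathcal{R}(F))\}$; its trunks are defined as for any partially colored forest. A vertex $v$ covers a set of edges if $v$ is an endpoint of every edge in the set. *)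

(* Defs.v *)
From mathcomp Require Import all_boot.
Unset Printing Implicit Defensive.

Section Graph.
Variables (T : finType) (e : rel T).

Definition simple_graph := symmetric e /\ irreflexive e.

Definition forest : Prop :=
  forall s : seq T, uniq s -> 2 < size s -> ~~ cycle e s.

Definition deg (v : T) : nat := #|[set u | e v u]|.

Definition E_gt2 : rel T := fun x y => e x y && ((2 < deg x) || (2 < deg y)).
Definition E_ggt2 : rel T := fun x y => [&& e x y, 2 < deg x & 2 < deg y].

Section Game.
Variable t : nat.
Definition pcol := {ffun T -> option 'I_t}.

Definition complete (f : pcol) := forall v, f v <> None.
Definition blocked (f : pcol) :=
  exists v, f v = None /\ forall c : 'I_t, exists u, e v u /\ f u = Some c.
Definition legal (f : pcol) (v : T) (c : 'I_t) :=
  f v = None /\ forall u, e v u -> f u <> Some c.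
Definition upd (f : pcol) (v : T) (c : 'I_t) : pcol :=
  [ffun x => if x == v then Some c else f x].

Inductive AWin : bool -> pcol -> Prop :=
| AW_done b f : complete f -> AWin b f
| AW_alice f v c : ~ complete f -> ~ blocked f -> legal f v c ->
    AWin false (upd f v c) -> AWin true f
| AW_bob f : ~ complete f -> ~ blocked f ->
    (forall v c, legal f v c -> AWin true (upd f v c)) -> AWin false f.

Definition alice_wins : Prop := AWin true [ffun _ => None].
End Game.

Definition is_game_chromatic_number (n : nat) : Prop :=
  alice_wins n /\ forall t, t < n -> ~ alice_wins t.

(* a subgraph is a pair (vertex set, set of ordered edge pairs, stored symmetrically) *)
Definition subg := ({set T} * {set (T * T)})%type.

Definition sub_valid (H : subg) : bool :=
  [forall x, forall y, ((x, y) \in H.2) ==>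
     [&& x \in H.1, y \in H.1, e x y & (y, x) \in H.2]].

Definition sub_connected (H : subg) : bool :=
  (H.1 != set0) &&
  [forall x in H.1, forall y in H.1, connect (fun u v => (u, v) \in H.2) x y].

Definition subdeg (H : subg) (x : T) : nat := #|[set y | (x, y) \in H.2]|.

Definition colored_leaves (C : {set T}) (H : subg) : bool :=
  [forall x in H.1, (x \in C) ==> (subdeg H x == 1)].

Definition trunk_cand (C : {set T}) (H : subg) : bool :=
  [&& sub_valid H, sub_connected H & colored_leaves C H].

Definition is_trunk (C : {set T}) (H : subg) : bool :=
  trunk_cand C H &&
  [forall H' : subg,
     [&& trunk_cand C H', H.1 \subset H'.1 & H.2 \subset H'.2] ==> (H' == H)].

End Graph.
Arguments simple_graph {T}. Arguments forest {T}. Arguments deg {T}.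
Arguments E_gt2 {T}. Arguments E_ggt2 {T}.
Arguments pcol T t : clear implicits.
Arguments complete {T t}. Arguments blocked {T} e {t}. Arguments legal {T} e {t}.
Arguments upd {T t}. Arguments AWin {T} e t. Arguments alice_wins {T} e t.
Arguments is_game_chromatic_number {T}. Arguments subg T : clear implicits.
Arguments sub_valid {T}. Arguments sub_connected {T}. Arguments subdeg {T}.
Arguments colored_leaves {T}. Arguments trunk_cand {T}. Arguments is_trunk {T}.

Section Reduced.
Variables (T : finType) (e : rel T) (C : {set T}).

(* vertices of R(F): a copy of each vertex of each trunk *)
Definition RV := {x : subg T * T | is_trunk e C x.1 && (x.2 \in x.1.1)}.

Definition R_edge : rel RV := fun x y =>
  ((val x).1 == (val y).1) && (((val x).2, (val y).2) \in (val x).1.2).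

Definition R_colored : {set RV} := [set x | (val x).2 \in C].

Definition R'_edge : rel RV := E_gt2 R_edge.

End Reduced.

Arguments RV {T}. Arguments R_edge {T}. Arguments R_colored {T}. Arguments R'_edge {T}.

(* Main.v *)
Require Import Defs.
From mathcomp Require Import all_boot.
Set Implicit Arguments.
Unset Strict Implicit.
Unset Printing Implicit Defensive.

(* Call a vertex big if its degree exceeds 2; only big vertices can become
   blocked with three colours.

   Alice keeps every trunk of the reduced graph as in (i) or (ii), except that a
   trunk of type (i) may have several coloured leaves, provided that they share
   their big neighbour b and their colour. When Bob colours
   a vertex w of such a trunk, she colours b. When he colours w in a trunk
   without coloured leaves and covered by v, she colours v (with the colour of w
   if w and v have a common big neighbour) or the big neighbour of w in the
   direction of v.

   Bob wins on a trunk with a coloured leaf and an edge xy between big vertices.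
   A sequence of forced moves carries the threat along the path to x; degree at
   least 4 then gives him room to threaten x and y at once. If two disjoint big
   edges lie in an uncoloured trunk, he colours a small vertex between them, or,
   if their ends are consecutive on a path of four big vertices, makes a double
   threat there. With at most two colours a single big edge already suffices. *)

(** Both directions go through [good_start], the trunk condition rewritten as connectivity in the
    forest minus [a]; copies of vertices and maximal subgraphs occur only when it is translated
    back. Acyclicity is used mainly in the form that distinct neighbours of [u] lie in distinct
    components of the forest minus [u]. One move of Alice away from [u] thus disturbs at most one of
    two branches at [u], so threats are prepared with two ways to carry them out. The exception in
    type (i) comes from Alice's own answer: when [v] gets the colour of [w], their common neighbour
    has two coloured neighbours but sees one colour, and so survives Bob's next move. Degree 4 is
    what the attack on an edge [xy] consumes at [y]: besides [x], one neighbour that makes [y] see a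
    colour, and two more, so that one is still usable after Alice's reply. A win with one or two
    colours does not by itself give a win with three, so few colours need an argument of their
    own. *)

Arguments E_gt2 : simpl never.

(** * Separation properties of a forest *)

Section Forest.
Variables (T : finType) (e : rel T).
Hypothesis (simp : simple_graph e) (acyc : forest e).

Let es : symmetric e. Proof. by case: simp. Qed.
Let ei : irreflexive e. Proof. by case: simp. Qed.

Definition big (x : T) := 2 < deg e x.

(** Vertex deletion on the same vertex type: [u] becomes isolated, and connectivity describes the
    branches at [u]. *)
Definition avoid (u : T) : rel T := [rel x y | [&& e x y, x != u & y != u]].

(** Degrees are those of the whole graph, not of its part inside [A]: colouring a vertex does not
    make its neighbours small. *)
Definition gt2_in (A : pred T) : rel T := [rel x y | [&& E_gt2 e x y, A x & A y]].

Lemma adj_neq x y : e x y -> x != y.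
Proof. by apply: contraTneq => ->; rewrite ei. Qed.

Lemma avoid_sym u : symmetric (avoid u).
Proof. by move=> x y; rewrite /avoid /= es; congr andb; rewrite andbC. Qed.

Lemma E_gt2_sym : symmetric (E_gt2 e).
Proof. by move=> x y; rewrite /E_gt2 es orbC. Qed.

Lemma gt2_in_sym A : symmetric (gt2_in A).
Proof. by move=> x y; rewrite /gt2_in /= E_gt2_sym; congr andb; rewrite andbC. Qed.

Lemma connect_avoidC u x y : connect (avoid u) x y = connect (avoid u) y x.
Proof. exact: (sym_connect_sym (@avoid_sym u)). Qed.

Lemma connect_gt2C A x y : connect (gt2_in A) x y = connect (gt2_in A) y x.
Proof. exact: (sym_connect_sym (@gt2_in_sym A)). Qed.

Lemma connect_avoid_neq u x y : connect (avoid u) x y -> x != u -> y != u.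
Proof.
move/connectP=> [p]; elim: p x => [|z p IH] x /=; first by move=> _ ->.
by case/andP=> /and3P[_ _ zu] pz /(IH z pz) H _; apply: H.
Qed.

Lemma avoid1 u x y : e x y -> x != u -> y != u -> connect (avoid u) x y.
Proof. by move=> xy xu yu; apply: connect1; rewrite /avoid /= xy xu. Qed.

Lemma avoid_step u x y z : connect (avoid u) x y -> e y z -> x != u -> z != u ->
  connect (avoid u) x z.
Proof.
move=> xy yz xu zu; apply: (connect_trans xy); apply: avoid1 yz _ zu.
exact: connect_avoid_neq xy xu.
Qed.

Lemma gt2_in_avoid (A : pred T) u x y : ~~ A u ->
  connect (gt2_in A) x y -> connect (avoid u) x y.
Proof.
move=> nAu; apply: connect_sub => {}x {}y /and3P[/andP[xy _] Ax Ay].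
by apply: avoid1 => //; apply: contraNneq nAu => <-.
Qed.

(** Otherwise the path from [u] to [v] closes to a cycle; since [v] lies beyond [w], this cycle has
    at least three vertices. *)
Lemma chord u w p v : path e u (w :: p) -> uniq (u :: w :: p) -> v \in p -> ~~ e v u.
Proof.
move=> pth un vp; apply/negP=> vu.
case/splitPr: vp pth un => p1 p2 pth un.
have /negP[] : ~~ cycle e (u :: w :: rcons p1 v).
  apply: acyc; last by rewrite /= size_rcons.
  move: un; rewrite -cat_rcons -!cat_cons cat_uniq; by case/andP.
rewrite /cycle rcons_path /=; apply/andP; split; last by rewrite last_rcons.
by move: pth; rewrite -cat_rcons /= cat_path; case/and3P=> -> ->.
Qed.

(** A simple path from [b] to [c] that misses [u] would close through [u] to a cycle. This is the
    main form in which acyclicity is used. *)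
Lemma avoid_sep u b c : e u b -> e u c -> connect (avoid u) b c -> b = c.
Proof.
move=> ub uc /connectP[p0 pth0 lst0].
case/shortenP: pth0 lst0 => p pth un _ lst {p0}.
case: p pth un lst => [|d p] pth un lst //.
have pe : path e b (d :: p).
  by apply: sub_path pth => x y /and3P[].
have nu : u \notin b :: d :: p.
  have bu : b != u by rewrite eq_sym adj_neq.
  rewrite inE negb_or eq_sym bu /=.
  elim: (d :: p) (b) pth => // y s IH x /= /andP[/and3P[_ _ yu] /IH H].
  by rewrite inE negb_or eq_sym yu.
suff /negP[] : ~~ e c u by rewrite es.
apply: (@chord u b (d :: p)); first by rewrite /= ub.
  by rewrite cons_uniq nu.
by rewrite lst /= mem_last.
Qed.

Lemma no_triangle x y z : e x y -> e x z -> e y z = false.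
Proof.
move=> xy xz; apply/negP=> yz; have yx := adj_neq xy; have zx := adj_neq xz.
have E : y = z by apply: (avoid_sep xy xz); apply: avoid1; rewrite // eq_sym.
by rewrite E ei in yz.
Qed.

Lemma no_square x y z v : e x y -> e x z -> e y v -> e z v -> v != x -> y = z.
Proof.
move=> xy xz yv zv vx; apply: (avoid_sep xy xz).
have yx := adj_neq xy; have zx := adj_neq xz.
apply: (@avoid_step x y v z); rewrite 1?eq_sym //; last by rewrite es.
by apply: avoid1 => //; rewrite eq_sym.
Qed.

(** A common vertex of the two sides would join [y] to the first vertex after [x] on the other
    route, and both are neighbours of [x]. *)
Lemma avoid_disj x y v : e x y -> connect (avoid y) x v -> connect (avoid x) y v -> False.
Proof.
move=> xy /connectP[p0 pth0 lst0] yv.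
have nyx : y != x by rewrite eq_sym adj_neq.
case/shortenP: pth0 lst0 => p pth un _ lst {p0}.
case: p pth un lst => [|d p] pth un lst.
  by have := connect_avoid_neq yv nyx; rewrite lst eqxx.
move: pth un; rewrite [path _ _ _]/= [uniq _]/= => /andP[/and3P[xd _ dy] pth].
case/andP=> xn _.
have dv : connect (avoid x) d v.
  apply/connectP; exists p; last by rewrite lst.
  elim: p d xn pth {xd dy lst} => // z s IH d.
  rewrite !inE !negb_or => /and3P[xd xz xs] /andP[/and3P[dz _ _] pth].
  apply/andP; split; first by apply/and3P; split; rewrite 1?eq_sym.
  by apply: IH => //; rewrite inE negb_or xz.
have := avoid_sep xy xd (connect_trans yv _).
by rewrite connect_avoidC => /(_ dv) E; rewrite E eqxx in dy.
Qed.

(** A vertex meeting both [z1] and [z2] would close a triangle or a square with [x]. So one move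
    away from [x] cannot spoil two neighbours of [x]. *)
Lemma unaffected x z1 z2 v : e x z1 -> e x z2 -> z1 != z2 -> v != x ->
  exists z, [/\ z \in [:: z1; z2], z != v & e z v = false].
Proof.
move=> x1 x2 z12 vx.
case: (eqVneq z1 v) => [E|n1].
  by exists z2; rewrite !inE eqxx orbT -E eq_sym z12 (no_triangle x2 x1).
case H1: (e z1 v); last by exists z1; rewrite !inE eqxx.
case: (eqVneq z2 v) => [E|n2].
  by rewrite -E (no_triangle x1 x2) in H1.
case H2: (e z2 v); last by exists z2; rewrite !inE eqxx orbT.
by rewrite (no_square x1 x2 H1 H2 vx) eqxx in z12.
Qed.

(** * Strategies of Bob *)

Section Moves.
Variable t : nat.
Implicit Types (f : pcol T t) (c d k : 'I_t).

Definition seen f v c := [exists u, e v u && (f u == Some c)].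

Lemma updE f v c x : upd f v c x = if x == v then Some c else f x.
Proof. by rewrite ffunE. Qed.

Lemma upd_eq f v c : upd f v c v = Some c.
Proof. by rewrite updE eqxx. Qed.

Lemma upd_neq f v c x : x != v -> upd f v c x = f x.
Proof. by rewrite updE => /negbTE ->. Qed.

Lemma seenP f v c : reflect (exists2 u, e v u & f u = Some c) (seen f v c).
Proof.
apply: (iffP existsP) => [[u /andP[vu /eqP fu]]|[u vu fu]]; exists u => //.
by rewrite vu fu eqxx.
Qed.

Lemma seen_upd f w d v c : f w = None -> seen f v c -> seen (upd f w d) v c.
Proof.
move=> fw /seenP[u vu fu]; apply/seenP; exists u => //.
by rewrite upd_neq //; apply: contraPneq fu => ->; rewrite fw.
Qed.

Lemma seen_new f w c v : e v w -> seen (upd f w c) v c.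
Proof. by move=> vw; apply/seenP; exists w; rewrite ?upd_eq. Qed.

Lemma legal_upd f z k v m : legal e f z k -> z != v -> (e z v -> m != k) ->
  legal e (upd f v m) z k.
Proof.
move=> [fz H] zv Hk; split; first by rewrite upd_neq.
move=> u zu; rewrite updE; case: eqP => [E|_]; last exact: H.
by case=> mk; move: (Hk); rewrite -E zu mk eqxx => /(_ isT).
Qed.

Lemma legal_free f z k : f z = None -> (forall u, e z u -> f u = None) -> legal e f z k.
Proof. by move=> fz H; split=> // u /H ->. Qed.

Lemma legal_not_complete f v c : legal e f v c -> ~ complete f.
Proof. by case=> fv _ /(_ v); rewrite fv. Qed.

Lemma Bob_wins_move f v c : legal e f v c -> ~ AWin e t true (upd f v c) ->
  ~ AWin e t false f.
Proof.
move=> L nW W; inversion W as [b f' cf| |f' nc nb H]; subst.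
  exact: (legal_not_complete L cf).
exact: nW (H _ _ L).
Qed.

Lemma Bob_wins_reply f x : f x = None ->
  (forall v c, legal e f v c -> ~ AWin e t false (upd f v c)) -> ~ AWin e t true f.
Proof.
move=> fx H W; inversion W as [b f' cf|f' v c nc nb L W'|]; subst.
  exact: cf fx.
exact: H L W'.
Qed.

Lemma Bob_wins_blocked b f : blocked e f -> ~ AWin e t b f.
Proof.
move=> B W; have [v [fv _]] := B.
inversion W as [b' f' cf|f' v' c nc nb L W'|f' nc nb H]; subst => //.
exact: cf fv.
Qed.

(** The colour [k] may be seen as well; an uncoloured [x] is then already blocked. *)
Definition sees_all_but f x k := forall c, c != k -> seen f x c.

Lemma sees_all_but_upd f x k v m : f v = None -> sees_all_but f x k ->
  sees_all_but (upd f v m) x k.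
Proof. by move=> fv S c /S; apply: seen_upd. Qed.

Lemma kill f x z k : f x = None -> sees_all_but f x k -> e x z -> legal e f z k ->
  ~ AWin e t false f.
Proof.
move=> fx S xz L; apply: (Bob_wins_move L); apply: Bob_wins_blocked.
exists x; split; first by rewrite upd_neq // adj_neq.
move=> c; case: (eqVneq c k) => [->|/S /(seen_upd k (proj1 L)) /seenP[u xu fu]].
  by exists z; rewrite upd_eq.
by exists u.
Qed.

(** A move of Alice away from [x] spoils at most one of [p] and [q]; the other receives [k] and
    blocks [x]. Her only defence is to give [x] the colour [k]. *)
Lemma forced f x p q k : f x = None -> sees_all_but f x k ->
  e x p -> e x q -> p != q -> legal e f p k -> legal e f q k ->
  (legal e f x k -> ~ AWin e t false (upd f x k)) -> ~ AWin e t true f.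
Proof.
move=> fx S xp xq pq Lp Lq W; apply: (Bob_wins_reply fx) => v m L.
case: (eqVneq v x) => [E|vx].
  rewrite E in L *; case: (eqVneq m k) => [mk|/S /seenP[u xu fu]].
    by rewrite mk in L *; apply: W.
  by case: L => _ /(_ _ xu); rewrite fu.
have fv := proj1 L.
have [z [zin zv zv']] := unaffected xp xq pq vx.
have Lz : legal e f z k by move: zin; rewrite !inE => /orP[] /eqP ->.
apply: (@kill _ x z k).
- by rewrite upd_neq // eq_sym.
- exact: sees_all_but_upd.
- by move: zin; rewrite !inE => /orP[] /eqP ->.
- by apply: legal_upd => //; rewrite zv'.
Qed.

End Moves.

(** * Attacks with three colours on an edge between big vertices *)

Section ThreeColors.
Implicit Types (f : pcol T 3) (c d k : 'I_3).

Lemma other_color c d : exists2 k, k != c & k != d.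
Proof.
have /subsetPn[k _] : ~~ ([set: 'I_3] \subset [set c; d]).
  apply/negP=> /subset_leq_card; rewrite cardsT card_ord cards2.
  by case: (c != d).
by rewrite !inE negb_or => /andP[kc kd]; exists k.
Qed.

Lemma color_cases c d k m : c != d -> c != k -> d != k -> m != k -> m = c \/ m = d.
Proof.
move=> cd ck dk mk; case: (eqVneq m c) => [|mc]; first by left.
case: (eqVneq m d) => [|md]; first by right.
have : #|[set c; d; k; m]| <= 3 by rewrite -[X in _ <= X]card_ord max_card.
have -> : #|[set c; d; k; m]| = 4 => //.
rewrite setUC cardsU1 !inE (negbTE mc) (negbTE md) (negbTE mk) /=.
by rewrite setUC cardsU1 !inE ![k == _]eq_sym (negbTE ck) (negbTE dk) cards2 cd.
Qed.

Lemma two_seen f x c d k : seen f x c -> seen f x d -> c != d -> c != k -> d != k ->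
  sees_all_but f x k.
Proof. by move=> sc sd cd ck dk m /(color_cases cd ck dk)[] ->. Qed.

(** The move at [z1] forces Alice to give [x] the colour [k]. This very answer makes [y] see a
    second colour, so the third one at [w] blocks [y]. *)
Lemma Bob_wins_edge2 f x y z1 z2 w c c' d k l :
  e x y -> e x z1 -> e x z2 -> e y w -> z1 != z2 -> z1 != y -> z2 != y -> w != x ->
  f x = None -> f y = None -> seen f x c -> seen f y c' ->
  c != d -> c != k -> d != k -> c' != k -> l != c' -> l != k ->
  legal e f z1 d -> legal e f z2 k -> legal e f y k -> legal e f w l ->
  ~ AWin e 3 false f.
Proof.
move=> xy xz1 xz2 yw z12 z1y z2y wx fx fy sc sc' cd ck dk c'k lc' lk L1 L2 Ly Lw.
have yx : e y x by rewrite es.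
have fz1 := proj1 L1.
have z1x : x != z1 by apply: adj_neq.
apply: (Bob_wins_move L1); apply: (@forced _ _ x z2 y k) => //.
- by rewrite upd_neq.
- apply: (two_seen (c := c) (d := d)) => //; first exact: seen_upd.
  exact: seen_new.
- by apply: legal_upd; rewrite // eq_sym.
- by apply: legal_upd; rewrite // eq_sym.
move=> Lx; have fx1 := proj1 Lx.
have wz1 : w != z1.
  by apply: contraTneq xz1 => <-; rewrite (no_triangle yx yw).
apply: (@kill _ _ y w l) => //.
- by rewrite !upd_neq // eq_sym // adj_neq.
- apply: (two_seen (c := c') (d := k)) => //; try by rewrite eq_sym.
    by apply: seen_upd => //; apply: seen_upd.
  exact: seen_new.
- apply: legal_upd; rewrite ?(no_triangle yw yx) //.
  apply: legal_upd => // wz1e.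
  case/eqP: wx; apply: (no_square yw yx wz1e xz1 z1y).
Qed.

(* Bob copies the colour c at a neighbour w1 of y, so that both ends see c while
   Alice can repair only one of them. The colour [al] is one that z1 and w2 may
   be unable to receive because of a coloured vertex two steps away. *)
Lemma Bob_wins_edge1 f x y z1 z2 w1 w2 w3 c al :
  e x y -> e x z1 -> e x z2 -> z1 != z2 -> z1 != y -> z2 != y ->
  e y w1 -> e y w2 -> e y w3 -> w1 != w2 -> w1 != w3 -> w2 != w3 ->
  w1 != x -> w2 != x -> w3 != x ->
  f x = None -> f y = None -> seen f x c ->
  (forall k, k != c -> legal e f x k) -> (forall k, legal e f y k) ->
  (forall k, k != al -> legal e f z1 k) -> (forall k, legal e f z2 k) ->
  legal e f w1 c -> (forall k, k != al -> legal e f w2 k) ->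
  (forall k, legal e f w3 k) -> ~ AWin e 3 false f.
Proof.
move=> xy xz1 xz2 z12 z1y z2y yw1 yw2 yw3 w12 w13 w23 w1x w2x w3x fx fy sc.
move=> Lx Ly L1 L2 Lw1 Lw2 Lw3.
have yx : e y x by rewrite es.
have fw1 := proj1 Lw1.
apply: (Bob_wins_move Lw1).
set f1 := upd f w1 c.
have nadj1 u : e y u -> u != w1 -> e u w1 = false by move=> yu _; rewrite (no_triangle yu yw1).
have zw1 z : e x z -> z != y -> z != w1 /\ (e z w1 = false).
  move=> xz zy; split.
    by apply: contraTneq xz => ->; rewrite (no_triangle yx yw1).
  apply/negP=> zw1; case/eqP: zy; apply: (no_square xz xy zw1 yw1 w1x).
have keep1 k u : legal e f u k -> u != w1 -> e u w1 = false -> legal e f1 u k.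
  by move=> Lu uw1 uw1'; apply: legal_upd => //; rewrite uw1'.
have Lx1 k : k != c -> legal e f1 x k.
  by move=> kc; apply: keep1; [exact: Lx|rewrite eq_sym|rewrite (no_triangle yx yw1)].
have Ly1 k : k != c -> legal e f1 y k.
  move=> kc; apply: legal_upd; [exact: Ly|exact: adj_neq|by rewrite eq_sym].
have L11 k : k != al -> legal e f1 z1 k.
  by move=> ka; have [? ?] := zw1 _ xz1 z1y; apply: keep1 => //; apply: L1.
have L21 k : legal e f1 z2 k.
  by have [? ?] := zw1 _ xz2 z2y; apply: keep1.
have Lw21 k : k != al -> legal e f1 w2 k.
  by move=> ka; apply: keep1; [exact: Lw2|rewrite eq_sym|apply: nadj1; rewrite // eq_sym].
have Lw31 k : legal e f1 w3 k.
  by apply: keep1; [exact: Lw3|rewrite eq_sym|apply: nadj1; rewrite // eq_sym].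
have sx1 : seen f1 x c by apply: seen_upd.
have sy1 : seen f1 y c by apply: seen_new.
have fx1 : f1 x = None by rewrite upd_neq // eq_sym.
have fy1 : f1 y = None by rewrite upd_neq // adj_neq.
clearbody f1; clear Lx Ly L1 L2 Lw1 Lw2 Lw3 keep1 fw1 fx fy sc f.
apply: (Bob_wins_reply fx1) => v m L; have fv := proj1 L.
have keep k u : legal e f1 u k -> u != v -> (e u v -> m != k) -> legal e (upd f1 v m) u k.
  exact: legal_upd.
(* If Alice colours one end, the other end sees [c] and the new colour and is blocked at once. *)
case: (eqVneq v x) => [E|vx].
  rewrite E in L fv keep *.
  have mc : c != m by apply: contraPneq L => <- [_]; have [u xu fu] := seenP _ _ _ sx1; move/(_ u xu).
  have [k kc km] := other_color c m.
  apply: (@kill _ _ y w3 k) => //.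
  - by rewrite upd_neq // adj_neq.
  - apply: (two_seen (c := c) (d := m)) => //; try by rewrite eq_sym.
      exact: seen_upd.
    exact: seen_new.
  - by apply: keep => //; rewrite (no_triangle yw3 yx).
case: (eqVneq v y) => [E|vy].
  rewrite E in L fv keep *.
  have mc : c != m by apply: contraPneq L => <- [_]; have [u xu fu] := seenP _ _ _ sy1; move/(_ u xu).
  have [k kc km] := other_color c m.
  apply: (@kill _ _ x z2 k) => //.
  - by rewrite upd_neq // adj_neq.
  - apply: (two_seen (c := c) (d := m)) => //; try by rewrite eq_sym.
      exact: seen_upd.
    exact: seen_new.
  - by apply: keep => //; rewrite (no_triangle xz2 xy).
have fx2 : upd f1 v m x = None by rewrite upd_neq // eq_sym.
have fy2 : upd f1 v m y = None by rewrite upd_neq // eq_sym.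
have sx2 : seen (upd f1 v m) x c by apply: seen_upd.
have sy2 : seen (upd f1 v m) y c by apply: seen_upd.
(* A neighbour of one end coloured differently from [c] makes that end see two colours, and the
   opposite end can take the third. *)
case: (boolP (e x v ==> (m == c))) => [xm|]; last first.
  rewrite negb_imply => /andP[xv mc]; have [k kc km] := other_color c m.
  apply: (@kill _ _ x y k) => //.
    apply: (two_seen (c := c) (d := m)) => //; try by rewrite eq_sym.
    exact: seen_new.
  by apply: keep; [exact: Ly1|rewrite eq_sym|rewrite (no_triangle xy xv)].
case: (boolP (e y v ==> (m == c))) => [ym|]; last first.
  rewrite negb_imply => /andP[yv mc]; have [k kc km] := other_color c m.
  apply: (@kill _ _ y x k) => //.
    apply: (two_seen (c := c) (d := m)) => //; try by rewrite eq_sym.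
    exact: seen_new.
  by apply: keep; [exact: Lx1|rewrite eq_sym|rewrite (no_triangle yx yv)].
(* Since [d] avoids [al], both [z1] and [w2] can receive it; the remaining colour [k] is asked only
   of [z2], [w3] and the ends. *)
have [d dc da] := other_color c al; have [k kc kd] := other_color c d.
have Lx2 : legal e (upd f1 v m) x k.
  by apply: keep; [exact: Lx1|rewrite eq_sym|move=> xv; move: xm; rewrite xv => /eqP ->; rewrite eq_sym].
have Ly2 : legal e (upd f1 v m) y k.
  by apply: keep; [exact: Ly1|rewrite eq_sym|move=> yv; move: ym; rewrite yv => /eqP ->; rewrite eq_sym].
have side a b u : e a b -> e a u -> u != b -> connect (avoid b) a u.
  by move=> ab au ub; apply: avoid1; rewrite // adj_neq.
(* A reply on the side of [x] leaves the other neighbours of [y] intact: the forcing starts at [y],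
   and [x] is blocked through whichever of [z1], [z2] survives. Otherwise the roles are
   exchanged. *)
case: (boolP (connect (avoid y) x v)) => [xsv|nxsv].
  have far u : e y u -> u != x -> u != v /\ e u v = false.
    move=> yu ux; have su := side _ _ _ yx yu ux; split.
      by apply: contraPneq xsv => <- xsu; apply: (avoid_disj xy xsu su).
    apply/negP=> uv; apply: (avoid_disj xy xsv).
    by apply: (avoid_step su uv) => //; rewrite eq_sym adj_neq.
  have [z [zin zv zv']] := unaffected xz1 xz2 z12 vx.
  have [xz zy] : e x z /\ z != y by move: zin; rewrite !inE => /orP[] /eqP ->.
  have Lz : legal e (upd f1 v m) z d.
    apply: keep => //; last by rewrite zv'.
    by move: zin; rewrite !inE => /orP[] /eqP -> //; apply: L11.
  have [n2 a2] := far _ yw2 w2x; have [n3 a3] := far _ yw3 w3x.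
  apply: (@Bob_wins_edge2 _ y x w2 w3 z c c d k d) => //; rewrite 1?eq_sym //.
  - by apply: keep => //; [exact: Lw21|rewrite a2].
  - by apply: keep => //; rewrite a3.
have far u : e x u -> u != y -> u != v /\ e u v = false.
  move=> xu uy; have su := side _ _ _ xy xu uy; split.
    by apply: contraNneq nxsv => <-.
  apply: contraNF nxsv => uv.
  by apply: (avoid_step su uv) => //; rewrite adj_neq.
have [w [win wv wv']] := unaffected yw2 yw3 w23 vy.
have [yw wx] : e y w /\ w != x by move: win; rewrite !inE => /orP[] /eqP ->.
have Lw : legal e (upd f1 v m) w d.
  apply: keep => //; last by rewrite wv'.
  by move: win; rewrite !inE => /orP[] /eqP -> //; apply: Lw21.
have [n1 a1] := far _ xz1 z1y; have [n2 a2] := far _ xz2 z2y.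
apply: (@Bob_wins_edge2 _ x y z1 z2 w c c d k d) => //; rewrite 1?eq_sym //.
- by apply: keep => //; [exact: L11|rewrite a1].
- by apply: keep => //; rewrite a2.
Qed.

Definition has_big_edge (s : seq T) := ~~ sorted [rel x y | ~~ (big x && big y)] s.

Lemma has_big_edge_cons x y s :
  has_big_edge [:: x, y & s] = (big x && big y) || has_big_edge (y :: s).
Proof. by rewrite /has_big_edge /= negb_and negbK. Qed.

(** [S] will be adjacency to the coloured vertex [a], which meets at most one neighbour of a given
    vertex. The exceptional element goes to [z1] here and to [w2] in [pick3_but], the positions
    where [Bob_wins_edge1] tolerates a missing colour. *)
Lemma pick2_but (A : {set T}) (S : pred T) : 1 < #|A| ->
  {in A &, forall z z', S z -> S z' -> z = z'} ->
  exists z1 z2, [/\ z1 \in A, z2 \in A, z1 != z2 & ~~ S z2].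
Proof.
case/card_gt1P=> x [y [xA yA xy]] inj; case: (boolP (S y)) => Sy.
  exists y, x; split; rewrite // 1?eq_sym //; apply: contraNN xy => Sx.
  by apply/eqP; apply: inj.
by exists x, y.
Qed.

Lemma pick3_but (A : {set T}) (S : pred T) : 2 < #|A| ->
  {in A &, forall z z', S z -> S z' -> z = z'} ->
  exists w1 w2 w3, [/\ w1 \in A, w2 \in A & w3 \in A] /\
    [/\ w1 != w2, w1 != w3, w2 != w3, ~~ S w1 & ~~ S w3].
Proof.
case/card_gt2P=> x [y [z [[xA yA zA] [xy yz zx]]]] inj.
have no p q : p \in A -> q \in A -> p != q -> S p -> ~~ S q.
  by move=> pA qA pq Sp; apply: contraNN pq => Sq; apply/eqP; apply: inj.
have [yx zy xz] : [/\ y != x, z != y & x != z] by split; rewrite eq_sym.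
case: (boolP (S x)) => Sx.
  by exists y, x, z; do 2!split; rewrite // (no x).
case: (boolP (S y)) => Sy.
  by exists x, y, z; do 2!split; rewrite // (no y).
by exists x, z, y.
Qed.

(** * Attacks along paths when no degree equals 3 *)

Hypothesis deg3 : forall v, deg e v <> 3.

(** Here the absence of degree 3 turns big into degree at least 4; the next two lemmas extract the
    spare neighbours that the attacks spend. *)
Lemma big_deg x : big x -> 3 < deg e x.
Proof. by rewrite /big leq_eqVlt => /orP[/eqP/esym/deg3|]. Qed.

Lemma big_nbrs1 x y : big x -> 2 < #|[set z | e x z & z != y]|.
Proof.
move/big_deg; rewrite /deg (cardsD1 y) => H.
have -> : [set z | e x z & z != y] = [set u | e x u] :\ y.
  by apply/setP=> z; rewrite !inE andbC.
by move: H; case: (y \in _) => //= /ltnW.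
Qed.

Lemma big_nbrs2 x y u : big x -> 1 < #|[set z | [&& e x z, z != u & z != y]]|.
Proof.
move/big_nbrs1 => /(_ y); rewrite (cardsD1 u) => H.
have -> : [set z | [&& e x z, z != u & z != y]] = [set z | e x z & z != y] :\ u.
  by apply/setP=> z; rewrite !inE andbCA.
by move: H; case: (u \in _) => //= /ltnW.
Qed.

Lemma small_nbrs x y z v : ~~ big x -> e x y -> e x z -> y != z -> e x v -> v = y \/ v = z.
Proof.
rewrite /big -leqNgt => small xy xz yz xv.
case: (eqVneq v y) => [|vy]; first by left.
case: (eqVneq v z) => [|vz]; first by right.
suff : 2 < deg e x by rewrite ltnNge small.
apply: (@leq_trans #|[set v; y; z]|).
  by rewrite -setUA cardsU1 !inE negb_or vy vz cards2 yz.
apply: subset_leq_card; apply/subsetP=> w; rewrite !inE.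
by case/orP=> [/orP[]|] /eqP ->.
Qed.

(* Along a path b, s1, b1, s2, ... the threat is pushed forward: colouring the
   small vertex s1 forces Alice to colour b, after which b1 is the big vertex
   with a coloured neighbour. *)
Lemma Bob_wins_path f u b p a c : e u b -> f u = Some c ->
  path (E_gt2 e) b p -> uniq (u :: b :: p) -> big b -> has_big_edge (b :: p) ->
  a \notin b :: p -> (forall v, v \in b :: p -> big v -> e a v -> a = u) ->
  (forall v, connect (avoid u) b v -> f v <> None -> v = a) ->
  ~ AWin e 3 false f.
Proof.
have [n] := ubnP (size p); elim: n p f u b c => // n IH [|y p] f u b c sz ub fu //.
move=> pth un bigb hbb ap au colored.
have pe : path e b (y :: p) by apply: sub_path pth => ? ? /andP[].
have bu : b != u by rewrite eq_sym adj_neq.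
have pathb : path e u (b :: y :: p) by rewrite [path _ _ _]/= ub.
have by_ : e b y by case/andP: pe.
have yu : y != u by case/andP: un; rewrite !inE !negb_or => /and3P[_ uy _] _; rewrite eq_sym.
have ab : a != b by move: ap; rewrite !inE !negb_or => /andP[].
have ay : a != y by move: ap; rewrite !inE !negb_or => /and3P[].
have cby : connect (avoid u) b y by apply: avoid1.
have free v : connect (avoid u) b v -> v != a -> f v = None.
  by move=> cv va; case E: (f v) => //; case/eqP: va; apply: colored; rewrite ?E.
have fb : f b = None by apply: free; rewrite // eq_sym.
have fy : f y = None by apply: free; rewrite // eq_sym.
have step x z : connect (avoid u) b x -> e x z -> z != u -> connect (avoid u) b z.
  by move=> cx xz zu; apply: (avoid_step cx).
have freeN x z : x \in b :: y :: p -> big x -> connect (avoid u) b x ->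
    e x z -> z != u -> f z = None.
  move=> xp bx cx xz zu; case E: (f z) => //.
  have za : z = a by apply: colored; [exact: step xz zu|rewrite E].
  by case/eqP: zu; rewrite za; apply: (au x) => //; rewrite -za es.
have adj_a z v : connect (avoid u) b z -> z != b -> e z v -> f v <> None -> v = a.
  move=> cz zb zv fv; apply: colored => //; apply: (step z) => //.
  apply: contraTneq zv => ->; apply: contraNN zb => zu; rewrite es in zu.
  by apply/eqP/esym; apply: (avoid_sep ub).
(* Only [a] may be coloured in this branch, so its colour is the only one that an uncoloured vertex
   of the branch other than [b] can lack. If [a] is uncoloured, the default merely excludes a colour
   that was available. *)
pose al := odflt ord0 (f a).
have legal_al z k : connect (avoid u) b z -> z != b -> f z = None -> k != al -> legal e f z k.
  move=> cz zb fz kal; split=> // v zv fv.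
  have va : v = a by apply: (adj_a z) => //; rewrite fv.
  by move: kal; rewrite /al -va fv eqxx.
have legal_any z k : connect (avoid u) b z -> z != b -> f z = None -> ~~ e z a -> legal e f z k.
  move=> cz zb fz za; apply: legal_free => // v zv; case E: (f v) => //.
  have va : v = a by apply: (adj_a z) => //; rewrite E.
  by rewrite -va zv in za.
have [|z1 [z2 [z1N z2N z12 z2a]]] := @pick2_but _ (fun z => e z a) (big_nbrs2 y u bigb).
  by move=> z z'; rewrite !inE => /andP[bz _] /andP[bz' _] za z'a; apply: (no_square bz bz' za z'a).
move: z1N z2N; rewrite !inE => /and3P[bz1 z1u z1y] /and3P[bz2 z2u z2y].
have okz z : e b z -> z != u -> [/\ connect (avoid u) b z, z != b & f z = None].
  move=> bz zu; split; first exact: avoid1.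
    by rewrite eq_sym adj_neq.
  by apply: (freeN b) => //; rewrite inE eqxx.
have [cz1 z1b fz1] := okz _ bz1 z1u; have [cz2 z2b fz2] := okz _ bz2 z2u.
have sc : seen f b c by apply/seenP; exists u; rewrite // es.
have uy0 : e y u = false by rewrite es (no_triangle _ by_) // es.
case: (boolP (big y)) => [bigy|smally].
  have [|w1 [w2 [w3 [[w1N w2N w3N] [w12 w13 w23 w1a w3a]]]]] :=
      @pick3_but _ (fun z => e z a) (big_nbrs1 b bigy).
    by move=> z z'; rewrite !inE => /andP[bz _] /andP[bz' _] za z'a; apply: (no_square bz bz' za z'a).
  move: w1N w2N w3N; rewrite !inE => /andP[yw1 w1b] /andP[yw2 w2b] /andP[yw3 w3b].
  have yw_u w : e y w -> w != u by apply: contraTneq => ->; rewrite uy0.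
  have okw w : e y w -> connect (avoid u) b w /\ f w = None.
    move=> yw; split; first by apply: (step y) => //; apply: yw_u.
    by apply: (freeN y) => //; [rewrite !inE eqxx orbT|apply: yw_u].
  have [cw1 fw1] := okw _ yw1; have [cw2 fw2] := okw _ yw2; have [cw3 fw3] := okw _ yw3.
  apply: (@Bob_wins_edge1 f b y z1 z2 w1 w2 w3 c al) => //.
  - move=> k kc; split=> // v bv; case: (eqVneq v u) => [->|vu].
      by rewrite fu => -[ck]; rewrite ck eqxx in kc.
    by rewrite (freeN b v) // inE eqxx.
  - move=> k; apply: legal_free => // v yv.
    by apply: (freeN y) => //; [rewrite !inE eqxx orbT|apply: yw_u].
  - by move=> k; apply: legal_al.
  - by move=> k; apply: legal_any.
  - by apply: legal_any.
  - by move=> k; apply: legal_al.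
  - by move=> k; apply: legal_any.
(* With [y] small the big edge lies further on, and the next vertex [y2] is big because an edge of
   [E_gt2] needs a big end. *)
move: hbb; rewrite has_big_edge_cons (negbTE smally) andbF /= => hbb.
case: p sz pth un hbb ap au freeN pathb pe => [|y2 p] // sz pth un hbb ap au freeN pathb pe.
have /and3P[_ yy2 pth'] := pth.
have bigy2 : big y2 by move: yy2; rewrite /E_gt2 -/(big y) -/(big y2) (negbTE smally) => /andP[].
have {}yy2 : e y y2 by case/andP: yy2.
have y2y : y2 != y by rewrite eq_sym adj_neq.
have y2b : y2 != b.
  by case/and3P: un => _; rewrite !inE !negb_or => /and3P[_ by2 _] _; rewrite eq_sym.
have y2u : y2 != u.
  by case/andP: un; rewrite !inE !negb_or => /and4P[_ _ uy2 _] _; rewrite eq_sym.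
have ay2 : a != y2 by move: ap; rewrite !inE !negb_or => /and4P[].
have fy2 : f y2 = None by apply: free; rewrite 1?eq_sym //; apply: (step y).
have yb : e y b by rewrite es.
(* Bob gives [d] to [y], and [k] is forced on [b]. The threat needs [z1] and [z2] to admit [k],
   hence [k] differs from [al]; [y] admits every colour because both its neighbours are uncoloured,
   so [d] may equal [al]. *)
have [d [k [dc kc kd kal]]] : exists d k, [/\ c != d, c != k, d != k & k != al].
  case: (eqVneq al c) => [->|alc].
    have [d dc _] := other_color c c; have [k kc kd] := other_color c d.
    by exists d, k; split; rewrite // eq_sym.
  have [k kc kd] := other_color c al.
  by exists al, k; split; rewrite // eq_sym.
have Ly : legal e f y d.
  apply: legal_free => // v yv.
  have bny2 : b != y2 by rewrite eq_sym.
  by have [->|->] := small_nbrs smally yb yy2 bny2 yv.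
apply: (Bob_wins_move Ly).
apply: (@forced _ _ b z1 z2 k) => //.
- by rewrite upd_neq // adj_neq.
- by apply: (two_seen (c := c) (d := d)) => //; [apply: seen_upd|apply: seen_new].
- by apply: legal_upd; rewrite ?(no_triangle bz1 by_) //; apply: legal_al; rewrite // eq_sym.
- by apply: legal_upd; rewrite ?(no_triangle bz2 by_) //; apply: legal_al; rewrite // eq_sym.
move=> Lb.
have nby2 : ~~ connect (avoid y) y2 b.
  by apply: contraNN y2b => H; apply/eqP; apply: (avoid_sep yy2 yb).
have yn : y \notin y2 :: p by move: un => /and3P[_ _ /andP[]].
(* Now [y] takes the role of [u]. The branch at [y2] lies inside the old one and excludes [b], so
   [a] is still the only vertex in it that may be coloured. *)
apply: (IH p _ y y2 d _ yy2) => //.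
- by rewrite /= !ltnS in sz; apply: ltnW.
- by rewrite upd_neq ?upd_eq // eq_sym adj_neq.
- by move: un => /and3P[].
- by move: hbb; rewrite has_big_edge_cons (negbTE smally).
- by move: ap; rewrite in_cons negb_or in_cons negb_or => /and3P[].
- move=> v vp bigv av; have vp' : v \in [:: b, y, y2 & p] by rewrite !inE in vp *; rewrite vp !orbT.
  have E := au v vp' bigv av.
  suff : ~~ e v u by rewrite es -E av.
  by apply: (chord pathb un); rewrite inE vp orbT.
move=> v cv fv.
have [vy vb vu] : [/\ v != y, v != b & connect (avoid u) b v].
  have cu w : connect (avoid y) y2 w -> w != u.
    move=> cw; apply: contraNneq nby2 => E; rewrite E in cw.
    by apply: (avoid_step cw) => //; rewrite adj_neq.
  split; first exact: (connect_avoid_neq cv).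
    by apply: contraNneq nby2 => <-.
  apply: (connect_trans (step _ _ cby yy2 y2u)).
  case/connectP: cv => q; elim/last_ind: q v {fv} => [|q x IHq] v; first by move=> _ ->.
  rewrite rcons_path last_rcons => /andP[pq /and3P[lx _ xy]] ->.
  apply: (avoid_step (IHq _ pq erefl)) => //; apply: cu.
  by apply: (@avoid_step y y2 (last y2 q)) => //; apply/connectP; exists q.
by apply: colored => //; move: fv; rewrite !upd_neq.
Qed.

Lemma legal_neq t (f : pcol T t) w (d : 'I_t) v m : legal e (upd f w d) v m -> v != w.
Proof. by case=> fv _; apply: contraPneq fv => ->; rewrite upd_eq. Qed.

(* Bob colours s: both sides of s then contain a big edge and a touched big
   vertex, and Alice can answer on one side only. *)
Lemma Bob_wins_middle f a b1 b2 s b4 p :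
  path (E_gt2 e) b1 [:: b2, s, b4 & p] -> uniq [:: b1, b2, s, b4 & p] ->
  big b1 -> big b2 -> ~~ big s -> has_big_edge (b4 :: p) ->
  a \notin [:: b1, b2, s, b4 & p] ->
  (forall v, v \in [:: b1, b2, s, b4 & p] -> big v -> ~~ e a v) ->
  (forall v, f v <> None -> v = a) -> ~ AWin e 3 false f.
Proof.
move=> pth un big1 big2 smalls hbb ap au colored.
have /and4P[/andP[b12 _] /andP[b2s _] sb4 pth4] := pth.
have big4 : big b4 by move: sb4; rewrite /E_gt2 -/(big s) -/(big b4) (negbTE smalls) => /andP[].
have {}sb4 : e s b4 by case/andP: sb4.
have sb2 : e s b2 by rewrite es.
have b21 : e b2 b1 by rewrite es.
have b24 : b2 != b4.
  by case/and3P: un => _; rewrite !inE !negb_or => /and3P[].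
have b1s : b1 != s.
  by case/andP: un; rewrite !inE !negb_or => /and4P[].
have s2 : s != b2 by exact: adj_neq.
have free v : v != a -> f v = None.
  by move=> va; case E: (f v) => //; case/eqP: va; apply: colored; rewrite E.
have na v : v \in [:: b1, b2, s, b4 & p] -> v != a by apply: contraTneq => ->.
have Ls : legal e f s ord0.
  apply: legal_free => [|v sv]; first by apply: free; apply: na; rewrite !inE eqxx !orbT.
  have [->|->] := small_nbrs smalls sb2 sb4 b24 sv;
    by apply: free; apply: na; rewrite !inE eqxx !orbT.
apply: (Bob_wins_move Ls).
have f1 : upd f s ord0 b2 = None.
  by rewrite upd_neq 1?eq_sym //; apply: free; apply: na; rewrite !inE eqxx !orbT.
apply: (Bob_wins_reply f1) => v m L.
have vs := legal_neq L.
have f2s : upd (upd f s ord0) v m s = Some ord0 by rewrite upd_neq ?upd_eq // eq_sym.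
have col b x : e s b -> connect (avoid s) b x -> x != v -> upd (upd f s ord0) v m x <> None -> x = a.
  move=> sb cx xv; rewrite upd_neq // upd_neq; first exact: colored.
  by apply: (connect_avoid_neq cx); rewrite eq_sym adj_neq.
case: (boolP (connect (avoid s) b2 v)) => [cv|ncv].
  apply: (@Bob_wins_path _ s b4 p a ord0) => //.
  - by case/and3P: un.
  - by move: ap; rewrite 3!in_cons !negb_or => /and4P[].
  - move=> x xp bx ax; suff : ~~ e a x by rewrite ax.
    by apply: au => //; rewrite 3!in_cons xp !orbT.
  - move=> x cx; apply: (col b4) => //; apply: contraNneq b24 => xv.
    by apply/eqP; apply: (avoid_sep sb2 sb4); rewrite (connect_trans cv) // connect_avoidC -xv.
apply: (@Bob_wins_path _ s b2 [:: b1] a ord0) => //.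
- by rewrite /= andbT E_gt2_sym; case/andP: pth.
- by rewrite /= !inE !negb_or andbT s2 eq_sym b1s eq_sym adj_neq.
- by rewrite has_big_edge_cons big1 big2.
- by move: ap; rewrite !inE !negb_or => /and3P[-> ->].
- move=> x xp bx ax; suff : ~~ e a x by rewrite ax.
  apply: au => //.
  by move: xp; rewrite !inE => /orP[] ->; rewrite ?orbT.
- move=> x cx; apply: (col b2) => //.
  by apply: contraNneq ncv => <-.
Qed.

(* Bob plays a neighbour of b1. If Alice answers beyond b3, the edge b1 b2 is
   lost; otherwise Bob colours b2, threatening both b1 and the edge b3 b4. *)
Lemma Bob_wins_four f a b1 b2 b3 b4 :
  e b1 b2 -> e b2 b3 -> e b3 b4 -> uniq [:: b1; b2; b3; b4] ->
  big b1 -> big b2 -> big b3 -> big b4 -> a \notin [:: b1; b2; b3; b4] ->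
  ~~ e a b1 -> ~~ e a b2 -> ~~ e a b3 -> ~~ e a b4 ->
  ~~ connect (avoid b3) b2 a ->
  (forall v, f v <> None -> v = a) -> ~ AWin e 3 false f.
Proof.
move=> b12 b23 b34 un big1 big2 big3 big4 aP a1 a2 a3 a4 aS colored.
have [b21 b32] : e b2 b1 /\ e b3 b2 by rewrite es b12 es b23.
have b13n : b1 != b3 by move: un; rewrite /= !inE !negb_or => /andP[/and3P[]].
have b24n : b2 != b4 by move: un; rewrite /= !inE !negb_or => /and3P[_ /andP[]].
have [b12n b23n b34n] : [/\ b1 != b2, b2 != b3 & b3 != b4] by split; apply: adj_neq.
have free v : v != a -> f v = None.
  by move=> va; case E: (f v) => //; case/eqP: va; apply: colored; rewrite E.
have clean z : connect (avoid b3) b2 z -> f z = None.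
  by move=> cz; apply: free; apply: contraNneq aS => <-.
have f3 : f b3 = None by apply: free; apply: contraNneq aP => <-; rewrite !inE eqxx !orbT.
have S2step x z : connect (avoid b3) b2 x -> e x z -> z != b3 -> connect (avoid b3) b2 z.
  by move=> cx xz zb; apply: (avoid_step cx).
have S2far x v : connect (avoid b3) b2 x -> x != b2 -> connect (avoid b2) b3 v -> e x v = false.
  move=> cx xb cv; apply: contraNF xb => xv.
  case: (eqVneq v b3) => [E|vb].
    by apply/eqP/esym; apply: (avoid_sep b32) => //; rewrite -E es.
  by case: (avoid_disj b23 (S2step _ _ cx xv vb) cv).
have disj x v : connect (avoid b3) b2 x -> connect (avoid b2) b3 v -> x != v.
  by move=> cx cv; apply: contraPneq cv => <- cv; apply: (avoid_disj b23 cx cv).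
have L0 z k : connect (avoid b3) b2 z -> legal e f z k.
  move=> cz; apply: legal_free => [|v zv]; first exact: clean.
  by case: (eqVneq v b3) => [->|vb] //; apply: clean; apply: (S2step z).
have S22 : connect (avoid b3) b2 b2 by [].
have S21 : connect (avoid b3) b2 b1 by apply: (S2step b2).
(* [r1] receives Bob's first move, [r2] and [r3] stay in reserve at [b1]; [u] and [z] serve the
   attack on [b2]. *)
have [|r1 [r2 [r3 [[]]]]] := @pick3_but _ pred0 (big_nbrs1 b2 big1); first by [].
rewrite !inE => /andP[br1 r1b] /andP[br2 r2b] /andP[br3 r3b] [r12 r13 r23 _ _].
have [|u [z]] := @pick2_but _ pred0 (big_nbrs2 b3 b1 big2); first by [].
rewrite !inE => -[/and3P[bu u1 u3] /and3P[bz z1 z3] uz _].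
have Sr r : e b1 r -> connect (avoid b3) b2 r.
  move=> br; apply: (S2step b1) => //.
  by apply: contraTneq br => ->; rewrite (no_triangle b21 b23).
have [Sr1 Sr2 Sr3] : [/\ connect (avoid b3) b2 r1, connect (avoid b3) b2 r2 & connect (avoid b3) b2 r3].
  by split; apply: Sr.
have [Su Sz] : connect (avoid b3) b2 u /\ connect (avoid b3) b2 z by split; apply: (S2step b2).
have b2r1 : e b2 r1 = false by rewrite (no_triangle b12 br1).
have fu1 w : e b2 w -> w != b1 -> w != r1 /\ e w r1 = false.
  move=> bw w1; split; first by apply: contraTneq bw => ->; rewrite b2r1.
  apply: contraNF w1 => wr; apply/eqP; exact: (no_square bw b21 wr br1 r1b).
have [ur1 ur1'] := fu1 _ bu u1; have [zr1 zr1'] := fu1 _ bz z1.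
pose c : 'I_3 := ord0.
apply: (Bob_wins_move (L0 r1 c Sr1)).
have L1 x k : connect (avoid b3) b2 x -> x != r1 -> (e x r1 -> c != k) -> legal e (upd f r1 c) x k.
  by move=> cx xr cm; apply: legal_upd => //; apply: L0.
have b1r1 : b1 != r1 by apply: adj_neq.
have b2r1n : b2 != r1 by rewrite eq_sym.
have b3r1 : b3 != r1.
  by rewrite eq_sym; apply: (connect_avoid_neq Sr1).
have f1b1 : upd f r1 c b1 = None by rewrite upd_neq // clean.
apply: (Bob_wins_reply f1b1) => v m L.
have vr1 := legal_neq L; have fv := proj1 L.
have s1 : seen (upd (upd f r1 c) v m) b1 c.
  by apply: seen_upd => //; apply: seen_new.
have col1 x : x != r1 -> x != v -> upd (upd f r1 c) v m x <> None -> x = a.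
  by move=> xr xv; rewrite !upd_neq //; apply: colored.
case: (boolP (connect (avoid b2) b3 v)) => [S3v|nS3v].
  have keep x k : connect (avoid b3) b2 x -> x != b2 -> x != r1 -> (e x r1 -> c != k) ->
      legal e (upd (upd f r1 c) v m) x k.
    move=> cx x2 xr cm; apply: legal_upd; [exact: L1|exact: disj|].
    by rewrite S2far.
  have b1v : b1 != v by apply: disj.
  have b2v : b2 != v by apply: disj.
  have [b1f b2f] : upd (upd f r1 c) v m b1 = None /\ upd (upd f r1 c) v m b2 = None.
    by rewrite !upd_neq // !clean.
  have kr r k : e b1 r -> r != b2 -> r1 != r -> legal e (upd (upd f r1 c) v m) r k.
    move=> br rb rr; apply: keep; rewrite ?(no_triangle br br1) // 1?eq_sym //.
    exact: Sr.
  have ku w k : e b2 w -> w != b1 -> w != b3 -> legal e (upd (upd f r1 c) v m) w k.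
    move=> bw w1 w3; have [wr wr'] := fu1 _ bw w1.
    apply: keep; rewrite ?wr' //; first exact: S2step S22 bw w3.
    by rewrite eq_sym adj_neq.
  (* If Alice coloured [b3], both ends of the edge [b1] [b2] already see a colour. Otherwise [b3]
     serves as [w2] with excluded colour [m], because [v] may be adjacent to it. *)
  case: (eqVneq v b3) => [E|vb3].
    have s2 : seen (upd (upd f r1 c) v m) b2 m by rewrite E; apply: seen_new.
    (* The triples [c], [d], [k] and [m], [k], [l] must each exhaust the colours; [k] is the colour
       forced on [b1]. *)
    have [d [k [l [dc kc kd mk [lm lk]]]]] : exists d k l, [/\ c != d, c != k, d != k,
       m != k & l != m /\ l != k].
      case: (eqVneq m c) => [->|mc].
        have [d dc _] := other_color c c; have [k kc kd] := other_color c d.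
        by exists d, k, d; split; last split; rewrite // eq_sym.
      have [k kc km] := other_color c m.
      by exists m, k, c; split; last split; rewrite // eq_sym.
    apply: (@Bob_wins_edge2 _ b1 b2 r2 r3 u c m d k l) => //.
    - exact: kr.
    - exact: kr.
    - by apply: legal_upd => //; apply: L1; rewrite ?b2r1.
    - exact: ku.
  apply: (@Bob_wins_edge1 _ b1 b2 r2 r3 u b3 z c m) => //.
  - by rewrite eq_sym.
  - by rewrite eq_sym.
  - by move=> k kc; apply: keep => //; rewrite eq_sym.
  - move=> k; apply: legal_upd => //; first by apply: L1; rewrite ?b2r1.
    by move=> b2v'; case/eqP: vb3; apply/esym; apply: (avoid_sep b23).
  - by move=> k _; apply: kr.
  - by move=> k; apply: kr.
  - exact: ku.
  - move=> k km; apply: legal_upd; [|by rewrite eq_sym|by rewrite eq_sym].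
    apply: legal_upd => //.
      apply: legal_free => // x b3x; apply: free; apply: contraNneq a3 => <-.
      by rewrite es.
    move=> b3r; case/eqP: b2r1n; exact: (avoid_sep b32).
  - by move=> k; apply: ku.
case: (eqVneq v b1) => [E|vb1].
  rewrite E in L fv col1 *.
  apply: (@Bob_wins_path _ b1 b2 [:: b3] a m) => //.
  - by rewrite upd_eq.
  - by rewrite /= /E_gt2 b23 -/(big b2) big2.
  - by rewrite /= !inE !negb_or b12n b13n b23n.
  - by rewrite has_big_edge_cons big2 big3.
  - by move: aP; rewrite !inE !negb_or => /and4P[_ -> ->].
  - by move=> x; rewrite !inE => /orP[] /eqP -> _; rewrite ?(negbTE a2) ?(negbTE a3).
  - move=> x cx; apply: col1.
      apply: contraPneq cx => -> cx; case/eqP: b2r1n; exact: (avoid_sep b12 br1).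
    by apply: (connect_avoid_neq cx); rewrite eq_sym.
have S3r1 x : connect (avoid b2) b3 x -> x != r1 by move=> cx; rewrite eq_sym; apply: disj.
(* Once [b2] is coloured while the side of [b3] has no coloured vertex except possibly [a], the
   touched edge [b3] [b4] decides the game. *)
have win34 (g : pcol T 3) d : g b2 = Some d -> (forall x, connect (avoid b2) b3 x -> g x <> None -> x = a) ->
    ~ AWin e 3 false g.
  move=> g2 gcol; apply: (@Bob_wins_path _ b2 b3 [:: b4] a d) => //.
  - by rewrite /= /E_gt2 b34 -/(big b3) big3.
  - by rewrite /= !inE !negb_or b23n b24n b34n.
  - by rewrite has_big_edge_cons big3 big4.
  - by move: aP; rewrite !inE !negb_or => /and4P[_ _ -> ->].
  - by move=> x; rewrite !inE => /orP[] /eqP -> _; rewrite ?(negbTE a3) ?(negbTE a4).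
have S3v x : connect (avoid b2) b3 x -> x != v by move=> cx; apply: contraNneq nS3v => <-.
case: (eqVneq v b2) => [E|vb2].
  apply: (win34 _ m); first by rewrite E upd_eq.
  by move=> x cx; apply: col1; [apply: S3r1|apply: S3v].
(* [d] avoids [m] because [v] may be adjacent to [b2], and avoids [c] so that [b1] then sees two
   colours. *)
have [d dc dm] := other_color c m.
have L2 : legal e (upd (upd f r1 c) v m) b2 d.
  apply: legal_upd; [|by rewrite eq_sym|by rewrite eq_sym].
  by apply: L1; rewrite ?b2r1.
apply: (Bob_wins_move L2).
have f3b1 : upd (upd (upd f r1 c) v m) b2 d b1 = None.
  by rewrite !upd_neq // 1?eq_sym // clean.
apply: (Bob_wins_reply f3b1) => v' m' L'.
have v'b2 := legal_neq L'; have fv' := proj1 L'.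
case: (boolP (connect (avoid b2) b3 v')) => [S3v'|nS3v'].
  have [r [rin rv rv']] := unaffected br2 br3 r23 vb1.
  have [br rb rr1] : [/\ e b1 r, r != b2 & r1 != r] by move: rin; rewrite !inE => /orP[] /eqP ->.
  have [k kc kd] := other_color c d.
  apply: (@kill _ _ b1 r k) => //.
  - by rewrite upd_neq //; apply: disj.
  - apply: (two_seen (c := c) (d := d)) => //; try by rewrite eq_sym.
      by apply: seen_upd => //; apply: seen_upd => //; case: L2.
    by apply: seen_upd => //; apply: seen_new.
  - apply: legal_upd; [|exact: disj (Sr _ br) S3v'|by rewrite (S2far _ _ (Sr _ br) rb S3v')].
    apply: legal_upd => //; last by rewrite (no_triangle br b12).
    apply: legal_upd; rewrite ?rv' //; apply: L1; rewrite ?(no_triangle br br1) // 1?eq_sym //.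
    exact: Sr.
apply: (win34 _ d); first by rewrite upd_neq ?upd_eq // eq_sym.
move=> x cx; have xv' : x != v' by apply: contraNneq nS3v' => <-.
rewrite upd_neq // upd_neq; first by apply: col1; [apply: S3r1|apply: S3v].
by apply: (connect_avoid_neq cx); rewrite eq_sym.
Qed.

(** * Good first vertices and stars of big edges *)

Definition big_edge (A : pred T) x y := [&& e x y, big x, big y, A x & A y].

(** In the first clause [b] is the big neighbour by which a trunk hangs on its coloured leaf [a].
    The second clause asks only that big edges of a component meet pairwise; [star_center] supplies
    the common vertex of (ii). *)
Definition good_start (a : T) :=
  (forall b x y, e a b -> big b -> connect (gt2_in (predC1 a)) b x ->
     ~~ big_edge (predC1 a) x y) /\
  (forall x y x' y', big_edge (predC1 a) x y -> big_edge (predC1 a) x' y' ->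
     connect (gt2_in (predC1 a)) x x' -> (x \in [:: x'; y']) || (y \in [:: x'; y'])).

Lemma big_edge_sym A : symmetric (big_edge A).
Proof.
by move=> x y; rewrite /big_edge es; case: (big x); case: (big y); rewrite //= [A x && _]andbC.
Qed.

Lemma big_edge_gt2 A x y : big_edge A x y -> gt2_in A x y.
Proof. by rewrite /gt2_in /= /E_gt2 -/(big x) => /and5P[-> -> _ -> ->]. Qed.

(** Pairwise meeting edges form a star or a triangle, and a forest has no triangle. *)
Lemma star_center (A : pred T) x y :
  (forall p q p' q', big_edge A p q -> big_edge A p' q' -> connect (gt2_in A) p p' ->
     (p \in [:: p'; q']) || (q \in [:: p'; q'])) ->
  big_edge A x y ->
  exists2 v, v \in [:: x; y] & forall x' y', connect (gt2_in A) x x' ->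
    big_edge A x' y' -> v \in [:: x'; y'].
Proof.
move=> s4 bxy.
pose cov v := [forall p, forall q, connect (gt2_in A) x p ==>
  (big_edge A p q ==> (v \in [:: p; q]))].
have covP v : cov v -> forall x' y', connect (gt2_in A) x x' ->
    big_edge A x' y' -> v \in [:: x'; y'].
  by move=> /forallP H p q xp bpq; have /forallP/(_ q) := H p; rewrite xp bpq.
have ncov v : ~~ cov v -> exists p q, [/\ connect (gt2_in A) x p,
    big_edge A p q & v \notin [:: p; q]].
  by case/forallPn=> p /forallPn[q]; rewrite !negb_imply => /and3P[]; exists p, q.
case: (boolP (cov x)) => [/covP H|/ncov[p [q [cp bpq xpq]]]].
  by exists x; rewrite ?inE ?eqxx.
case: (boolP (cov y)) => [/covP H|/ncov[p' [q' [cp' bpq' ypq]]]].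
  by exists y; rewrite ?inE ?eqxx ?orbT.
have orient v p0 q0 : connect (gt2_in A) x p0 -> big_edge A p0 q0 ->
    v \in [:: p0; q0] -> exists z, [/\ connect (gt2_in A) x v,
    big_edge A v z, z \in [:: p0; q0] & forall u, u \in [:: p0; q0] -> u = v \/ u = z].
  move=> c0 b0; rewrite !inE => /orP[] /eqP ->.
    exists q0; rewrite !inE eqxx orbT; split=> // u.
    by rewrite !inE => /orP[] /eqP ->; [left|right].
  exists p0; rewrite !inE eqxx big_edge_sym b0; split=> //.
    by apply: (connect_trans c0); apply: connect1; apply: big_edge_gt2.
  by move=> u; rewrite !inE => /orP[] /eqP ->; [right|left].
have ypq0 : y \in [:: p; q].
  by have := s4 _ _ _ _ bxy bpq cp; rewrite (negbTE xpq).
have xpq0 : x \in [:: p'; q'].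
  by have := s4 _ _ _ _ bxy bpq' cp'; rewrite (negbTE ypq) orbF.
have [z [cy byz zpq Hz]] := orient _ _ _ cp bpq ypq0.
have [z' [cx bxz zpq' Hz']] := orient _ _ _ cp' bpq' xpq0.
have [xy yz xz] : [/\ e x y, e y z & e x z'].
  by split; [case/and5P: bxy|case/and5P: byz|case/and5P: bxz].
have cyx : connect (gt2_in A) y x by rewrite connect_gt2C.
have := s4 _ _ _ _ byz bxz cyx; rewrite !inE.
case/orP=> /orP[] /eqP E.
- by rewrite E ei in xy.
- by rewrite E zpq' in ypq.
- by rewrite -E zpq in xpq.
- by rewrite -E in xz; rewrite (no_triangle xy xz) in yz.
Qed.

(** In a forest, a neighbour of the last vertex that lies on the path must be its predecessor, so
    the big edge is the final edge of the path. *)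
Lemma has_big_edge_end z p y : path e z p -> uniq (z :: p) -> e (last z p) y ->
  big (last z p) -> big y -> y \in z :: p -> has_big_edge (z :: p).
Proof.
elim: p z => [|w p IH] z /=.
  by move=> _ _ zy _ _; rewrite inE => /eqP E; rewrite E ei in zy.
case/andP=> zw pth un xy bx bigy; rewrite has_big_edge_cons inE.
case/orP=> [/eqP E|yp]; last by rewrite (IH w) ?orbT //; case/andP: un.
have := mem_last w p; rewrite inE => /orP[/eqP E'|xp].
  by rewrite -E' bx -E bigy.
have : ~~ e (last w p) z by apply: (chord _ un xp); apply/andP.
by rewrite -E xy.
Qed.

Lemma has_big_edge_rcons z p y : big (last z p) -> big y -> has_big_edge (z :: rcons p y).
Proof.
move=> + by_; elim: p z => [|w p IH] z /= bx; rewrite has_big_edge_cons; first by rewrite bx by_.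
by rewrite IH ?orbT.
Qed.

Lemma gt2_path_e A z p : path (gt2_in A) z p -> path e z p.
Proof. by apply: sub_path => x y /and3P[/andP[]]. Qed.

Lemma gt2_path_E A z p : path (gt2_in A) z p -> path (E_gt2 e) z p.
Proof. by apply: sub_path => x y /and3P[]. Qed.

Lemma gt2_path_in (A : pred T) z p v : A z -> path (gt2_in A) z p -> v \in z :: p -> A v.
Proof.
elim: p z v => [|w p IH] z v Az; first by rewrite inE => _ /eqP ->.
move=> /andP[/and3P[_ _ Aw] pth]; rewrite inE => /orP[/eqP -> //|].
exact: IH.
Qed.

(** A path to one end of a big edge may or may not run through the other end; either way it becomes
    a path containing the edge, as the attacks along paths require. *)
Lemma gt2_path_extend (A : pred T) z p y : A z -> path (gt2_in A) z p -> uniq (z :: p) ->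
  big_edge A (last z p) y ->
  exists q, [/\ path (gt2_in A) z (p ++ q), uniq (z :: p ++ q),
     has_big_edge (z :: p ++ q) & {subset q <= [:: y]}].
Proof.
move=> Az pth un bxy; have /and5P[xy bx by_ _ _] := bxy.
case: (boolP (y \in z :: p)) => yp.
  exists [::]; rewrite cats0; split=> //.
  exact: has_big_edge_end (gt2_path_e pth) un xy bx by_ yp.
exists [:: y]; rewrite cats1; split=> //.
- by rewrite rcons_path pth big_edge_gt2.
- by rewrite -rcons_cons rcons_uniq yp.
- exact: has_big_edge_rcons.
Qed.

(** A window slides along the path between two disjoint big edges until its third vertex is small
    ([Bob_wins_middle]) or four consecutive vertices are big ([Bob_wins_four]). A small fourth
    vertex after a big third one shifts the window by one. *)
Lemma Bob_wins_star f a b1 b2 p :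
  path (E_gt2 e) b1 (b2 :: p) -> uniq [:: b1, b2 & p] -> big b1 -> big b2 ->
  has_big_edge p -> a \notin [:: b1, b2 & p] ->
  (forall v, v \in [:: b1, b2 & p] -> big v -> ~~ e a v) ->
  (forall v, f v <> None -> v = a) -> ~ AWin e 3 false f.
Proof.
elim: p b1 b2 => [|s p IH] b1 b2 // pth un big1 big2 hbb ap au colored.
case: p IH pth un hbb ap au => [|b4 p] // IH pth un hbb ap au.
case: (boolP (big s)) => bigs; last first.
  apply: (@Bob_wins_middle f a _ _ _ _ _ pth un) => //.
  by move: hbb; rewrite has_big_edge_cons (negbTE bigs).
have sub v : v \in [:: b1; b2; s; b4] -> v \in [:: b1, b2, s, b4 & p].
  by rewrite !inE => /or4P[] ->; rewrite ?orbT.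
case: (boolP (big b4)) => big4; last first.
  apply: (IH b2 s) => //.
  - by case/andP: pth.
  - by case/andP: un.
  - by move: hbb; rewrite has_big_edge_cons (negbTE big4) andbF.
  - by move: ap; rewrite in_cons negb_or => /andP[].
  - by move=> v vp; apply: au; rewrite in_cons vp orbT.
have /and4P[/andP[b12 _] /andP[b2s _] /andP[s4 _] _] := pth.
have un4 : uniq [:: b1; b2; s; b4].
  by move: un; rewrite -[_ :: _]/([:: b1; b2; s; b4] ++ p) cat_uniq => /andP[].
have ap4 : a \notin [:: b1; b2; s; b4] by apply: contraNN ap; apply: sub.
have [a1 a2 a3 a4] : [/\ ~~ e a b1, ~~ e a b2, ~~ e a s & ~~ e a b4].
  by split; apply: au => //; apply: sub; rewrite !inE eqxx ?orbT.
(* [Bob_wins_four] needs [a] away from the side of [b2]; if it is there, the four vertices are read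
   backwards. *)
case: (boolP (connect (avoid s) b2 a)) => ca.
  apply: (@Bob_wins_four f a b4 s b2 b1); rewrite // 1?es //.
  - by rewrite -(rev_uniq [:: b1; b2; s; b4]) in un4.
  - by move: ap4; rewrite -mem_rev.
  - by apply/negP=> ca'; apply: (avoid_disj b2s ca ca').
exact: (@Bob_wins_four f a b1 b2 s b4).
Qed.

Lemma Bob_wins_bad_start f a c : f a = Some c -> (forall v, f v <> None -> v = a) ->
  AWin e 3 false f -> good_start a.
Proof.
move=> fa colored W; set A := predC1 a.
have goodA b x y : e a b -> big b -> connect (gt2_in A) b x -> ~~ big_edge A x y.
  move=> ab bigb cx; apply/negP=> bxy; suff : ~ AWin e 3 false f by [].
  have Ab : A b by rewrite /A /= eq_sym adj_neq.
  case/connectP: cx => p0 pth0 lst0; case/shortenP: pth0 lst0 => p pth un _ lst {p0}.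
  rewrite lst in bxy; have [q [pthq unq hbb _]] := gt2_path_extend Ab pth un bxy.
  have naq : a \notin b :: (p ++ q).
    by apply/negP=> /(gt2_path_in Ab pthq); rewrite /A /= eqxx.
  apply: (@Bob_wins_path f a b (p ++ q) a c) => //.
  - exact: gt2_path_E pthq.
  - by rewrite cons_uniq naq.
  - by move=> v _; apply: colored.
split=> // x y x' y' bxy bxy' cxx'.
apply/negPn/negP; rewrite negb_or => /andP[xn yn].
suff : ~ AWin e 3 false f by [].
have /and5P[xy bx by_ Ax Ay] := bxy.
case/connectP: cxx' => p0 pth0 lst0; case/shortenP: pth0 lst0 => p pth un _ lst {p0}.
(* The path is made to start with the whole edge [x] [y]. If [y] lies on it, then right after [x],
   since a later position would give a chord; otherwise [y] is put in front. *)
have [b1 [b2 [q [pthq unq Ab1 big1 [big2 lstq b1n b2n]]]]] :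
    exists b1 b2 q, [/\ path (gt2_in A) b1 (b2 :: q), uniq [:: b1, b2 & q], A b1, big b1 &
      [/\ big b2, last b2 q = x', b1 \notin [:: x'; y'] & b2 \notin [:: x'; y']]].
  case: (boolP (y \in p)) => yp; last first.
    exists y, x, p; split=> //.
      by apply/andP; split=> //; rewrite gt2_in_sym; apply: big_edge_gt2.
    by rewrite cons_uniq un inE negb_or yp !andbT eq_sym adj_neq.
  case: p pth un lst yp => [|w p] // pth un lst; rewrite inE => /orP[/eqP E|yp].
    by exists x, y, p; rewrite E in yn by_ *; split.
  have : ~~ e y x by apply: (chord (gt2_path_e pth) un).
  by rewrite es xy.
case: q pthq unq lstq => [|h q] pthq unq lstq.
  by rewrite -lstq inE eqxx in b2n.
have pthh : path (gt2_in A) h q by case/and3P: pthq.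
have Ah : A h by apply: (gt2_path_in Ab1 pthq); rewrite !inE eqxx !orbT.
have unh : uniq (h :: q) by case/and3P: unq.
rewrite -[x'](lstq) in bxy'.
have [r [pthr unr hbb rs]] := gt2_path_extend Ah pthh unh bxy'.
have pthf : path (gt2_in A) b1 [:: b2, h & q ++ r].
  by move: pthq => /= /and3P[-> ->].
have unf : uniq [:: b1, b2, h & q ++ r].
  have nr b : b \notin [:: x'; y'] -> b \notin h :: q -> b \notin (h :: q) ++ r.
    move=> bn bq; rewrite mem_cat negb_or bq; apply: contraNN bn => /rs.
    by rewrite !inE => ->; rewrite orbT.
  move: unq => /and3P[]; rewrite inE negb_or => /andP[b12 b1q] b2q _.
  rewrite cons_uniq in_cons negb_or b12 (nr b1) //=.
  by rewrite -[h :: q ++ r]/((h :: q) ++ r) (nr b2).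
apply: (Bob_wins_star (gt2_path_E pthf) unf big1 big2 hbb _ _ colored).
  by apply/negP=> /(gt2_path_in Ab1 pthf); rewrite /A /= eqxx.
(* A big neighbour of [a] on the path would reach the big edge [x'] [y'], against the first
   clause. *)
move=> v vp bigv; apply/negP=> av; rewrite lstq in bxy'.
suff : ~~ big_edge A x' y' by rewrite bxy'.
apply: (goodA v) => //.
have vx z : z \in [:: b1, b2, h & q ++ r] -> connect (gt2_in A) b1 z.
  by move=> zp; apply: (path_connect pthf).
apply: (@connect_trans _ _ b1); last first.
  by apply: vx; rewrite -lstq -cat_cons -!cat_cons mem_cat /= 2!in_cons mem_last !orbT.
by rewrite connect_gt2C; apply: vx.
Qed.

(** Besides [c] there is at most one colour [k], possibly equal to [c]. A big neighbour of [a] is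
    blocked at once; otherwise [c] at [z1] leaves only [k] for [x], and after that [c] at [w] blocks
    [y]. *)
Lemma Bob_wins_few t (f : pcol T t) a (c : 'I_t) x y : t < 3 ->
  f a = Some c -> (forall v, f v <> None -> v = a) -> big_edge (predC1 a) x y ->
  ~ AWin e t false f.
Proof.
move=> t3 fa colored bxy.
have [k ck] : exists k : 'I_t, forall m, m = c \/ m = k.
  have t0 : 0 < t by apply: leq_ltn_trans (ltn_ord c).
  (* For [t] at most 2 the values are [0] and [t.-1], which coincide when [t] is 1. *)
  have H (i j m : 'I_t) : i = 0 :> nat -> j = t.-1 :> nat -> m = i \/ m = j.
    move=> i0 j1; case: (posnP m) => m0; [left|right]; apply: val_inj => /=.
      by rewrite i0 m0.
    rewrite j1; apply/eqP; rewrite eqn_leq -ltnS prednK // ltn_ord /=.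
    by apply: leq_trans m0; rewrite -ltnS prednK.
  have lt_t : t.-1 < t by rewrite prednK.
  case: (posnP c) => c0.
    by exists (Ordinal lt_t) => m; apply: H.
  have cl : c = t.-1 :> nat.
    have [E|->] // := H (Ordinal t0) (Ordinal lt_t) c erefl erefl.
    by rewrite E in c0.
  by exists (Ordinal t0) => m; apply/or_comm; apply: H.
have free v : v != a -> f v = None.
  by move=> va; case E: (f v) => //; case/eqP: va; apply: colored; rewrite E.
have L z m : z != a -> ~~ e z a -> legal e f z m.
  move=> za nza; apply: legal_free => [|u zu]; first exact: free.
  by apply: free; apply: contraNneq nza => <-.
have touched x0 y0 : big_edge (predC1 a) x0 y0 -> e a x0 -> ~ AWin e t false f.
  move=> /and5P[xy bx _ xa _] ax.
  have [|_ [z [_ + _ _]]] := @pick2_but _ pred0 (big_nbrs2 a y0 bx); first by [].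
  rewrite !inE => /and3P[xz za zy]; rewrite es in ax.
  apply: (@kill _ _ x0 z k) => //; first exact: free.
    move=> m mk; have [->|E] := ck m; last by rewrite E eqxx in mk.
    by apply/seenP; exists a.
  by apply: L => //; rewrite (no_triangle xz ax).
case: (boolP (e a x)) => ax; first exact: touched bxy ax.
case: (boolP (e a y)) => ay.
  by apply: (touched y x) => //; rewrite big_edge_sym.
have /and5P[xy bx by_ xa ya] := bxy; rewrite /= in xa ya.
have sel v w : big v -> ~~ e a v -> v != a -> exists w1 w2, [/\ e v w1, e v w2, w1 != w2,
    w1 != w & w2 != w] /\ [/\ w1 != a, w2 != a, ~~ e w1 a & ~~ e w2 a].
  move=> bv av va.
  have [|w1 [w0 [w2 [[w1N _ w2N] [_ w12 _ w1a w2a]]]]] :=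
      @pick3_but _ (fun z => e z a) (big_nbrs1 w bv).
    move=> z z'; rewrite !inE => /andP[vz _] /andP[vz' _] za z'a.
    by apply: (no_square vz vz' za z'a); rewrite eq_sym.
  move: w1N w2N; rewrite !inE => /andP[v1 w1w] /andP[v2 w2w].
  exists w1, w2; split=> //; split=> //.
    by apply: contraNneq av => <-; rewrite es.
  by apply: contraNneq av => <-; rewrite es.
have [z1 [z2 [[xz1 xz2 z12 z1y z2y] [z1a z2a nz1 nz2]]]] := sel x y bx ax xa.
have [w [w' [[yw _ _ wx _] [wa _ nw _]]]] := sel y x by_ ay ya.
have yx : e y x by rewrite es.
apply: (Bob_wins_move (L z1 c z1a nz1)).
apply: (@forced _ _ x z2 y k) => //.
- by rewrite upd_neq ?free // adj_neq.
- move=> m mk; have [->|E] := ck m; last by rewrite E eqxx in mk.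
  exact: seen_new.
- apply: legal_upd; [exact: L|by rewrite eq_sym|by rewrite (no_triangle xz2 xz1)].
- apply: legal_upd; [|by rewrite eq_sym|by rewrite (no_triangle xy xz1)].
  by apply: L => //; rewrite es.
move=> Lx; apply: (@kill _ _ y w c) => //.
- by rewrite upd_neq ?adj_neq // upd_neq ?free // eq_sym.
- move=> m mc; have [E|->] := ck m; first by rewrite E eqxx in mc.
  exact: seen_new.
- apply: legal_upd; rewrite ?(no_triangle yw yx) //.
  apply: legal_upd; first exact: L.
    by apply: contraTneq xz1 => <-; rewrite (no_triangle yx yw).
  by move=> wz1; case/eqP: wx; apply: (no_square yw yx wz1 xz1).
Qed.

Lemma alice_wins_good_start n : 0 < #|T| -> n < 4 -> alice_wins e n -> exists a, good_start a.
Proof.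
case/card_gt0P=> x0 _ n4 W; inversion W as [b f' cf|f' v c nc nb L W'|]; subst.
  by have := cf x0; rewrite ffunE.
have fv : upd [ffun=> None] v c v = Some c by rewrite upd_eq.
have col u : upd [ffun=> None] v c u <> None -> u = v.
  by rewrite !ffunE; case: eqP.
exists v; move: n4; rewrite ltnS leq_eqVlt => /orP[/eqP E|n3].
  by subst n; apply: Bob_wins_bad_start fv col W'.
(* With fewer than three colours no big edge avoids [v], and both clauses hold vacuously. *)
have no x y : ~~ big_edge (predC1 v) x y.
  by apply/negP=> bxy; apply: (Bob_wins_few n3 fv col bxy W').
by split=> [b x y _ _ _|x y x' y' bxy]; rewrite ?no //; case/negP: (no x y).
Qed.

End ThreeColors.

(** * The strategy of Alice *)

Section AliceStrategy.
Implicit Types (f : pcol T 3) (c d k m : 'I_3).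

Definition uncolored f : pred T := fun x => f x == None.

(** Coloured leaves survive in the reduced graph only next to such vertices: a coloured copy has
    degree 1, so the other end of its edge must be big. *)
Definition touched f b := [&& uncolored f b, big b & [exists u, e b u && ~~ uncolored f u]].

(* The components of [gt2_in (uncolored f)] are the trunks of the reduced graph
   stripped of their coloured leaves; a component may carry several coloured
   leaves as long as they share both their neighbour and their colour. *)
Definition safe f : Prop := [/\
  forall b c c', uncolored f b -> big b -> seen f b c -> seen f b c' -> c = c',
  forall b b', touched f b -> touched f b' ->
    connect (gt2_in (uncolored f)) b b' -> b = b',
  forall b x y, touched f b -> connect (gt2_in (uncolored f)) b x ->
    ~~ big_edge (uncolored f) x y &
  forall x y x' y', big_edge (uncolored f) x y -> big_edge (uncolored f) x' y' ->
    connect (gt2_in (uncolored f)) x x' -> (x \in [:: x'; y']) || (y \in [:: x'; y'])].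

Definition new_touched f f' b :=
  [&& uncolored f' b, big b & [exists u, [&& e b u, uncolored f u & ~~ uncolored f' u]]].

Definition extends f f' := forall v, ~~ uncolored f v -> f' v = f v.

Lemma extends_uncolored f f' v : extends f f' -> uncolored f' v -> uncolored f v.
Proof. by move=> ext; apply: contraLR => fv; rewrite /uncolored ext. Qed.

Lemma connect_extends f f' x y : extends f f' ->
  connect (gt2_in (uncolored f')) x y -> connect (gt2_in (uncolored f)) x y.
Proof.
move=> ext; apply: connect_sub => {}x {}y /and3P[xy fx fy].
by apply: connect1; apply/and3P; split=> //; apply: (extends_uncolored ext).
Qed.

Lemma big_edge_extends f f' x y : extends f f' ->
  big_edge (uncolored f') x y -> big_edge (uncolored f) x y.
Proof.
move=> ext /and5P[xy bx by_ fx fy].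
by rewrite /big_edge xy bx by_ /= !(extends_uncolored ext).
Qed.

Lemma touched_extends f f' b : extends f f' -> touched f' b ->
  new_touched f f' b || touched f b.
Proof.
move=> ext /and3P[fb bb /existsP[u /andP[bu fu]]].
rewrite /new_touched /touched fb bb (extends_uncolored ext fb) /=.
case: (boolP (uncolored f u)) => fu'; apply/orP; [left|right]; apply/existsP; exists u.
  by rewrite bu fu' fu.
by rewrite bu fu'.
Qed.

(** Further colouring only shrinks components and removes big edges, so the invariant can fail only
    at vertices that gained a coloured neighbour. *)
Lemma safe_extends f f' : safe f -> extends f f' ->
  (forall b c c', new_touched f f' b -> seen f' b c -> seen f' b c' -> c = c') ->
  (forall b b', new_touched f f' b -> new_touched f f' b' ->
     connect (gt2_in (uncolored f')) b b' -> b = b') ->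
  (forall b b', new_touched f f' b -> touched f b' -> uncolored f' b' ->
     ~~ connect (gt2_in (uncolored f)) b b') ->
  (forall b x y, new_touched f f' b -> connect (gt2_in (uncolored f')) b x ->
     ~~ big_edge (uncolored f') x y) ->
  safe f'.
Proof.
move=> [s1 s2 s3 s4] ext n1 n2 n3 n4; split.
- move=> b c c' fb bb; case: (boolP (new_touched f f' b)) => [nb|]; first exact: n1.
  rewrite /new_touched fb bb /= => nb.
  have old k : seen f' b k -> seen f b k.
    case/seenP=> u bu fu; apply/seenP; exists u => //.
    rewrite -fu ext //; apply: contraNN nb => fu'; apply/existsP; exists u.
    by rewrite bu fu' /uncolored fu.
  by move=> /old sc /old sc'; apply: (s1 b) => //; apply: (extends_uncolored ext).
- move=> b b' tb tb' cbb'; have ub := andP tb; have ub' := andP tb'.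
  have cf := connect_extends ext cbb'.
  case/orP: (touched_extends ext tb) => nb; case/orP: (touched_extends ext tb') => nb'.
  + exact: n2.
  + by have := n3 _ _ nb nb' ub'.1; rewrite cf.
  + by have := n3 _ _ nb' nb ub.1; rewrite connect_gt2C cf.
  + exact: s2.
- move=> b x y tb cbx; case/orP: (touched_extends ext tb) => nb; first exact: n4 cbx.
  by apply: contraNN (s3 b x y nb (connect_extends ext cbx)); apply: big_edge_extends.
- move=> x y x' y' bxy bxy' cxx'; apply: s4.
  + exact: big_edge_extends bxy.
  + exact: big_edge_extends bxy'.
  + exact: connect_extends cxx'.
Qed.

Lemma uncolored_upd f v c x : uncolored (upd f v c) x = (x != v) && uncolored f x.
Proof. by rewrite /uncolored updE; case: (x == v). Qed.

Lemma extends_upd f v c : uncolored f v -> extends f (upd f v c).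
Proof. by move=> fv x fx; rewrite upd_neq //; apply: contraNneq fx => ->. Qed.

Lemma extends_trans f f' f'' : extends f f' -> extends f' f'' -> extends f f''.
Proof.
move=> e1 e2 v fv; rewrite e2; first exact: e1.
by rewrite /uncolored e1.
Qed.

Lemma new_touched_upd f v c b : new_touched f (upd f v c) b -> e b v.
Proof.
case/and3P=> _ _ /existsP[u /and3P[bu fu]].
by rewrite uncolored_upd fu andbT negbK => /eqP <-.
Qed.

Lemma seenN_legal f v k : uncolored f v -> ~~ seen f v k -> legal e f v k.
Proof.
move=> /eqP fv ns; split=> // u vu fu; case/negP: ns; apply/seenP; by exists u.
Qed.

Lemma small_free_color f v : ~~ big v -> exists k, ~~ seen f v k.
Proof.
move=> sv; apply/existsP; apply: contraNT sv; rewrite negb_exists => /forallP H.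
have -> : big v = (#|[set Some k | k : 'I_3]| <= deg e v).
  by rewrite card_imset ?card_ord //; apply: Some_inj.
apply: leq_trans (leq_imset_card f _); apply: subset_leq_card.
apply/subsetP=> _ /imsetP[k _ ->]; have := H k; rewrite negbK => /seenP[u vu fu].
by apply/imsetP; exists u; rewrite ?inE.
Qed.

Lemma gt2_edge f x y : e x y -> big x || big y -> uncolored f x -> uncolored f y ->
  connect (gt2_in (uncolored f)) x y.
Proof.
by move=> xy bb fx fy; apply: connect1; apply/and3P; split=> //; rewrite /E_gt2 xy.
Qed.

(** Alice has to move even when nothing needs repair. *)
Lemma safe_waiting_move f v0 : safe f -> uncolored f v0 ->
  exists v m, legal e f v m /\ safe (upd f v m).
Proof.
move=> sf fv0; have [s1 s2 s3 s4] := sf.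
(* Colouring a touched vertex touches nothing new: an uncoloured big neighbour would form with it a
   big edge in a touched component. *)
case: (boolP [exists b, touched f b]) => [/existsP[b tb]|/existsPn nt].
  have /and3P[fb bb /existsP[u /andP[bu fu]]] := tb.
  have [c fuc] : exists c, f u = Some c.
    by move: fu; rewrite /uncolored; case: (f u) => // c; exists c.
  have sc : seen f b c by apply/seenP; exists u.
  have [m mc _] := other_color c c.
  exists b, m; split.
    apply: seenN_legal => //; apply: contraNN mc => sm; apply/eqP; exact: (s1 b).
  have no b' : ~~ new_touched f (upd f b m) b'.
    apply/negP=> nb'; have b'b := new_touched_upd nb'.
    case/and3P: nb' => fb' bb' _; move: fb'; rewrite uncolored_upd => /andP[_ fb'].
    have := s3 b b b' tb (connect0 _ _).
    by rewrite /big_edge es b'b bb bb' fb fb'.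
  apply: safe_extends sf _ _ _ _ _; first exact: extends_upd.
  - by move=> b' c1 c2; rewrite (negbTE (no b')).
  - by move=> b' b''; rewrite (negbTE (no b')).
  - by move=> b' b''; rewrite (negbTE (no b')).
  - by move=> b' x y; rewrite (negbTE (no b')).
(* Nothing is touched. Colouring the centre [v] of the star of big edges removes them all from its
   component and puts the neighbours of [v] into different components; without big edges any big
   vertex serves. *)
case: (boolP [exists b, uncolored f b && big b]) => [/existsP[b0 /andP[fb0 bb0]]|/existsPn nb].
  have [v [fv bv cov]] : exists v, [/\ uncolored f v, big v & forall x y,
      connect (gt2_in (uncolored f)) v x -> big_edge (uncolored f) x y -> v \in [:: x; y]].
    case: (boolP [exists x, exists y, connect (gt2_in (uncolored f)) b0 x &&
        big_edge (uncolored f) x y]) => [/existsP[x /existsP[y /andP[cx bxy]]]|no].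
      have [v vxy H] := star_center s4 bxy; exists v.
      have /and5P[xy bx by_ fx fy] := bxy.
      have cxv : connect (gt2_in (uncolored f)) x v.
        move: vxy; rewrite !inE => /orP[] /eqP -> //.
        by apply: connect1; apply: big_edge_gt2.
      split; [by move: vxy; rewrite !inE => /orP[] /eqP ->|by move: vxy; rewrite !inE => /orP[] /eqP ->|].
      by move=> p q vp; apply: H; apply: (connect_trans cxv).
    exists b0; split=> // x y cx bxy; case/negP: no.
    by apply/existsP; exists x; apply/existsP; exists y; rewrite cx.
  have free b u : uncolored f b -> big b -> e b u -> uncolored f u.
    move=> fb bb bu; apply: contraNT (nt b) => fu; rewrite /touched fb bb /=.
    by apply/existsP; exists u; rewrite bu.
  exists v, ord0; split.
    by apply: legal_free; [exact/eqP|move=> u vu; apply/eqP; apply: free vu].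
  have ext := extends_upd ord0 fv.
  have nbv b : new_touched f (upd f v ord0) b -> [/\ e v b, uncolored f b & big b].
    move=> nb; have bv' := new_touched_upd nb; case/and3P: nb => fb bb _.
    by rewrite es bb (extends_uncolored ext fb).
  have vcol : ~~ uncolored (upd f v ord0) v by rewrite uncolored_upd eqxx.
  apply: (safe_extends sf ext).
  - move=> b c c' /nbv[vb fb bb].
    have sees k : seen (upd f v ord0) b k -> k = ord0.
      case/seenP=> u bu; rewrite updE; case: eqP => [_ [<-]//|_ fu].
      by have := free b u fb bb bu; rewrite /uncolored fu.
    by move=> /sees -> /sees ->.
  - move=> b b' /nbv[vb _ _] /nbv[vb' _ _] cbb'.
    exact: (avoid_sep vb vb' (gt2_in_avoid vcol cbb')).
  - by move=> b b' _ tb'; case/negP: (nt b').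
  - move=> b x y /nbv[vb fb bb] cbx; apply/negP=> bxy.
    have /and5P[_ _ _ fx fy] := bxy.
    have cvx : connect (gt2_in (uncolored f)) v x.
      apply: (@connect_trans _ _ b); last exact: connect_extends ext cbx.
      by apply: gt2_edge => //; rewrite bb orbT.
    have := cov x y cvx (big_edge_extends ext bxy).
    by rewrite !inE => /orP[] /eqP E; [rewrite -E in fx|rewrite -E in fy]; case/negP: vcol.
(* Only small vertices remain uncoloured, and they see at most two of the three colours. *)
have small b : uncolored f b -> ~~ big b by move=> fb; have := nb b; rewrite fb.
have [k nk] := small_free_color f (small v0 fv0).
exists v0, k; split; first exact: seenN_legal.
have no b : ~~ new_touched f (upd f v0 k) b.
  apply/negP=> /and3P[fb bb _]; move: fb; rewrite uncolored_upd => /andP[_ /small].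
  by rewrite bb.
apply: safe_extends sf _ _ _ _ _; first exact: extends_upd.
- by move=> b' c1 c2; rewrite (negbTE (no b')).
- by move=> b' b''; rewrite (negbTE (no b')).
- by move=> b' b''; rewrite (negbTE (no b')).
- by move=> b' x y; rewrite (negbTE (no b')).
Qed.

Lemma safe_sees f b c : safe f -> uncolored f b -> big b -> seen f b c ->
  forall k, seen f b k -> k = c.
Proof. by move=> [s1 _ _ _] fb bb sc k sk; apply: (s1 b). Qed.

Lemma seen_updE f v m b k : seen (upd f v m) b k -> e b v /\ k = m \/ seen f b k.
Proof.
case/seenP=> u bu; rewrite updE; case: eqP => [uv [<-]|_ fu]; first by left; rewrite -uv.
by right; apply/seenP; exists u.
Qed.

Lemma extends_upd2 f v m w c : uncolored f w -> uncolored (upd f w c) v ->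
  extends f (upd (upd f w c) v m).
Proof. by move=> fw fv; apply: (@extends_trans _ (upd f w c)); apply: extends_upd. Qed.

Lemma new_touched_upd2 f v m w c b : uncolored f w -> uncolored (upd f w c) v ->
  new_touched f (upd (upd f w c) v m) b ->
  [/\ b != v, b != w, uncolored f b, big b & e b w || e b v].
Proof.
move=> fw fv /and3P[fb bb /existsP[u /and3P[bu fu]]].
move: fb; rewrite !uncolored_upd fu andbT => /and3P[-> -> ->].
by rewrite negb_and !negbK bb => /orP[] /eqP <-; rewrite bu ?orbT.
Qed.

(** * Alice's answer to a move of Bob *)

Section Answer.
Variables (f : pcol T 3) (w : T) (c : 'I_3).
Hypotheses (sf : safe f) (fw : uncolored f w).

Let f1 := upd f w c.

Let touched_comp b := [&& touched f b, b != w & connect (gt2_in (uncolored f)) w b].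

(** The component had no big edge, and [b0] was its only touched vertex. With [b0] coloured, the
    newly touched vertices are neighbours of [w], separated by [w], and see only [c]. The new colour
    also avoids [c] because [b0] may be adjacent to [w]. *)
Lemma answer_touched b0 : touched_comp b0 -> exists v m, legal e f1 v m /\ safe (upd f1 v m).
Proof.
case/and3P=> tb0 b0w cw0; have [s1 s2 s3 s4] := sf.
have /and3P[fb0 bb0 /existsP[u /andP[bu fu]]] := tb0.
have [c0 fuc] : exists c0, f u = Some c0.
  by move: fu; rewrite /uncolored; case: (f u) => // c0; exists c0.
have sc0 : seen f b0 c0 by apply/seenP; exists u.
have [m mc0 mc] := other_color c0 c.
have f1b0 : uncolored f1 b0 by rewrite uncolored_upd b0w.
have ext := extends_upd2 m fw f1b0.
exists b0, m; split.
  apply: seenN_legal => //; apply/negP=> /seen_updE[[_ E]|sm].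
    by rewrite E eqxx in mc.
  by rewrite (safe_sees sf fb0 bb0 sc0 sm) eqxx in mc0.
have nbw b : new_touched f (upd f1 b0 m) b ->
    [/\ e w b, e b b0 = false, b != b0, uncolored f b & big b]
    /\ connect (gt2_in (uncolored f)) b0 b.
  case/(new_touched_upd2 fw f1b0) => bb0n bw fb bb.
  have nbb0 : e b b0 = false.
    apply/negP=> ebb0; have := s3 b0 b0 b tb0 (connect0 _ _).
    by rewrite /big_edge es ebb0 bb bb0 fb fb0.
  rewrite nbb0 orbF => ebw; split; first by rewrite es.
  rewrite connect_gt2C; apply: connect_trans cw0.
  by apply: gt2_edge; rewrite ?bb.
have fresh b : new_touched f (upd f1 b0 m) b -> ~~ touched f b.
  move=> /nbw[[_ _ bn fb bb] cb]; apply/negP=> tb.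
  by rewrite (s2 _ _ tb0 tb cb) eqxx in bn.
have vcol : ~~ uncolored (upd f1 b0 m) w by rewrite !uncolored_upd eqxx andbF.
apply: (safe_extends sf ext).
- move=> b k k' nb; have [[wb bb0n bn fb bb] cb] := nbw b nb.
  have sees j : seen (upd f1 b0 m) b j -> j = c.
    case/seen_updE=> [[]|]; first by rewrite bb0n.
    case/seen_updE=> [[]|/seenP[x bx fx]] //; case/negP: (fresh b nb).
    by rewrite /touched fb bb /=; apply/existsP; exists x; rewrite bx /uncolored fx.
  by move=> /sees -> /sees ->.
- move=> b b' /nbw[[wb _ _ _ _] _] /nbw[[wb' _ _ _ _] _] cbb'.
  exact: (avoid_sep wb wb' (gt2_in_avoid vcol cbb')).
- move=> b b' /nbw[_ cb] tb' fb'; apply/negP=> cbb'.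
  have E := s2 _ _ tb0 tb' (connect_trans cb cbb').
  by rewrite -E uncolored_upd eqxx in fb'.
- move=> b x y /nbw[_ cb] cbx; apply: contraNN (s3 b0 x y tb0 _).
    exact: big_edge_extends.
  exact: (connect_trans cb (connect_extends ext cbx)).
Qed.

Hypothesis no_touched : forall b, ~~ touched_comp b.

Let fresh b u : uncolored f b -> big b -> b != w ->
  connect (gt2_in (uncolored f)) w b -> e b u -> uncolored f u.
Proof.
move=> fb bb bw cwb bu; apply: contraNT (no_touched b) => fu.
by rewrite /touched_comp /touched fb bb bw cwb /= andbT; apply/existsP; exists u; rewrite bu.
Qed.

(** Apart from [w] itself nothing in its component was touched, so the newly touched vertices see
    only [c] and are separated by [w]. A big edge within their reach is the only possible
    failure. *)
Lemma safe_after : (forall b x y, new_touched f f1 b ->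
    connect (gt2_in (uncolored f1)) b x -> ~~ big_edge (uncolored f1) x y) -> safe f1.
Proof.
move=> H; have ext := extends_upd c fw.
have vcol : ~~ uncolored f1 w by rewrite uncolored_upd eqxx.
have nbw b : new_touched f f1 b -> [/\ e w b, b != w, uncolored f b, big b &
    connect (gt2_in (uncolored f)) w b].
  move=> nb; have bw := new_touched_upd nb; case/and3P: nb => fb bb _.
  have fb' := extends_uncolored ext fb.
  by rewrite es bw adj_neq // fb' bb; split=> //; apply: gt2_edge; rewrite ?bb ?orbT // es.
apply: (safe_extends sf ext) => //.
- move=> b k k' /nbw[wb bw fb bb cwb].
  have sees j : seen f1 b j -> j = c.
    case/seen_updE=> [[]|/seenP[x bx fx]] //.
    by have := fresh fb bb bw cwb bx; rewrite /uncolored fx.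
  by move=> /sees -> /sees ->.
- move=> b b' /nbw[wb _ _ _ _] /nbw[wb' _ _ _ _] cbb'.
  exact: (avoid_sep wb wb' (gt2_in_avoid vcol cbb')).
- move=> b b' /nbw[_ _ _ _ cb] tb' fb'; apply/negP=> cbb'.
  move: fb'; rewrite uncolored_upd => /andP[b'w _]; case/negP: (no_touched b').
  by rewrite /touched_comp tb' b'w (connect_trans cb).
Qed.

(** Every big edge in the component of [w] contains [v], so the invariant on big edges is restored
    once [v] is coloured or out of reach of the newly touched vertices. *)
Lemma answer_threat b x y : new_touched f f1 b ->
  connect (gt2_in (uncolored f1)) b x -> big_edge (uncolored f1) x y ->
  exists v m, legal e f1 v m /\ safe (upd f1 v m).
Proof.
move=> nb cbx bxy1; have ext1 := extends_upd c fw.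
have bw := new_touched_upd nb; have wb : e w b by rewrite es.
have [f1b bb _] := and3P nb; have fb := extends_uncolored ext1 f1b.
have bxy := big_edge_extends ext1 bxy1.
have [_ _ _ s4] := sf; have [v vxy cov0] := star_center s4 bxy.
have cwb : connect (gt2_in (uncolored f)) w b by apply: gt2_edge; rewrite ?bb ?orbT.
have cwx := connect_trans cwb (connect_extends ext1 cbx).
have cov p q : connect (gt2_in (uncolored f)) w p -> big_edge (uncolored f) p q -> v \in [:: p; q].
  by move=> cwp; apply: cov0; apply: connect_trans cwp; rewrite connect_gt2C.
have [f1v bv cbv] : [/\ uncolored f1 v, big v & connect (gt2_in (uncolored f1)) b v].
  have := bxy1 => /and5P[xy bx by_ fx fy].
  move: vxy; rewrite !inE => /orP[] /eqP -> //; split=> //.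
  by apply: (connect_trans cbx); apply: connect1; apply: big_edge_gt2.
have fv := extends_uncolored ext1 f1v.
have vw : v != w by move: f1v; rewrite uncolored_upd => /andP[].
have bw' : b != w by apply: adj_neq.
have cwv := connect_trans cwb (connect_extends ext1 cbv).
have wcol : ~~ uncolored f1 w by rewrite uncolored_upd eqxx.
have cbv_w := gt2_in_avoid wcol cbv.
have seen1 z k : uncolored f z -> big z -> z != w ->
    connect (gt2_in (uncolored f)) w z -> seen f1 z k -> e z w /\ k = c.
  move=> fz bz zw cwz /seen_updE[|/seenP[u zu fu]] //.
  by have := fresh fz bz zw cwz zu; rewrite /uncolored fu.
have uncovered g p q : extends f g -> ~~ uncolored g v -> big_edge (uncolored g) p q ->
    ~~ connect (gt2_in (uncolored f)) w p.
  move=> ext gv bpq; apply/negP=> cwp; have := cov p q cwp (big_edge_extends ext bpq).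
  by move: bpq => /and5P[_ _ _ gp gq]; rewrite !inE => /orP[] /eqP E; rewrite E ?gp ?gq in gv.
(* A vertex adjacent to both [w] and [v] must see a single colour: it cannot exist when [v] is
   adjacent to [w], and otherwise [m] is [c]. *)
have play_v m : legal e f1 v m -> (e v w || (m == c)) ->
    (v = b \/ e b v) -> safe (upd f1 v m).
  move=> L mc vb; have ext := extends_upd2 m fw f1v.
  have vcol : ~~ uncolored (upd f1 v m) v by rewrite uncolored_upd eqxx.
  have wcol2 : ~~ uncolored (upd f1 v m) w by rewrite !uncolored_upd eqxx andbF.
  have nbz z : new_touched f (upd f1 v m) z -> [/\ z != v, z != w, uncolored f z, big z &
      e z w || e z v] /\ connect (gt2_in (uncolored f)) w z.
    move=> nz; have := new_touched_upd2 fw f1v nz; case=> zv zw fz bz zz; split=> //.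
    case/orP: zz => zz; first by apply: gt2_edge; rewrite ?bz ?orbT // es.
    by apply: (connect_trans cwv); apply: gt2_edge; rewrite ?bz ?orbT // es.
  (* The route from [z] to [v] avoids [w], so [z] is [b]. This is absurd when [v] is [b]; otherwise
     [z] and [z'] are both neighbours of [v], which separates them unless they are equal. *)
  have sep_wv z z' : e z w -> e z' v -> z != v -> z' != w ->
      connect (gt2_in (uncolored (upd f1 v m))) z z' -> z = z'.
    move=> zw z'v zv z'w cz; have cw := gt2_in_avoid wcol2 cz.
    have zw' : z != w by apply: adj_neq.
    have czv : connect (avoid w) z v by apply: (avoid_step cw z'v).
    have wz : e w z by rewrite es.
    case: vb => [E|ebv].
      by case/eqP: zv; apply: (avoid_sep wz) => //; rewrite E.
    have zb : z = b by apply: (avoid_sep wz wb); apply: (avoid_step czv); rewrite // es.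
    have [vz vz'] : e v z /\ e v z' by rewrite zb !(es v).
    exact: (avoid_sep vz vz' (gt2_in_avoid vcol cz)).
  apply: (safe_extends sf ext).
  - move=> z k k' /nbz[[zv zw fz bz _] cwz].
    case/seen_updE=> [[zv' ->]|/(seen1 z k fz bz zw cwz)[zw' ->]];
    case/seen_updE=> [[zv'' ->]|/(seen1 z k' fz bz zw cwz)[zw'' ->]] //.
      by case/orP: mc => [vw'|/eqP //]; rewrite (no_triangle zv' zw'') in vw'.
    by case/orP: mc => [vw'|/eqP //]; rewrite (no_triangle zv'' zw') in vw'.
  - move=> z z' /nbz[[zv zw fz bz zz] _] /nbz[[z'v z'w fz' bz' zz'] _] czz'.
    case/orP: zz => zz; case/orP: zz' => zz'.
    + by apply: (@avoid_sep w); rewrite 1?es //; apply: gt2_in_avoid wcol2 czz'.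
    + exact: sep_wv czz'.
    + by apply/esym; apply: sep_wv => //; rewrite connect_gt2C.
    + by apply: (@avoid_sep v); rewrite 1?es //; apply: gt2_in_avoid vcol czz'.
  - move=> z z' /nbz[_ cwz] tz' fz'; apply/negP=> czz'.
    move: fz'; rewrite !uncolored_upd => /and3P[_ z'w _]; case/negP: (no_touched z').
    by rewrite /touched_comp tz' z'w (connect_trans cwz).
  - move=> z p q /nbz[_ cwz] czp; apply/negP=> bpq.
    have := uncovered _ _ _ ext vcol bpq.
    by rewrite (connect_trans cwz (connect_extends ext czp)).
have legal1 z m : uncolored f1 z -> uncolored f z -> big z ->
    connect (gt2_in (uncolored f)) w z -> z != w -> (e z w -> m != c) -> legal e f1 z m.
  move=> f1z fz bz cwz zw mc; apply: seenN_legal => //; apply/negP.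
  by move=> /(seen1 z m fz bz zw cwz)[/mc + E]; rewrite E eqxx.
have [m mc _] := other_color c c.
case: (eqVneq v b) => [vb|vb].
  exists v, m; have L : legal e f1 v m by apply: legal1.
  by split=> //; apply: play_v => //; [rewrite vb bw|left].
case: (boolP (e b v)) => ebv.
  have nvw : e v w = false by rewrite (no_triangle ebv bw).
  exists v, c; have L : legal e f1 v c by apply: legal1; rewrite ?nvw.
  by split=> //; apply: play_v => //; [rewrite eqxx orbT|right].
(* Here [v] lies beyond [b] and its neighbours. Colouring [b] touches no further vertex at [b],
   since a big neighbour would form with [b] a big edge that misses [v]; and another neighbour of
   [w] reaching [v] would lie in the branch of [b]. *)
exists b, m; split; first exact: legal1.
have ext := extends_upd2 m fw f1b.
have wcol2 : ~~ uncolored (upd f1 b m) w by rewrite !uncolored_upd eqxx andbF.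
have nbz z : new_touched f (upd f1 b m) z -> [/\ z != b, z != w, uncolored f z, big z &
    e z b = false] /\ e w z /\ connect (gt2_in (uncolored f)) w z.
  move=> nz; have := new_touched_upd2 fw f1b nz; case=> zb zw fz bz zz.
  have nzb : e z b = false.
    apply/negP=> ezb; have : v \in [:: b; z].
      by apply: cov => //; rewrite /big_edge es ezb bb bz fb fz.
    by rewrite !inE (negbTE vb) => /eqP E; rewrite E es ezb in ebv.
  rewrite nzb orbF in zz; split=> //; rewrite es; split=> //.
  by apply: gt2_edge; rewrite ?bz ?orbT // es.
apply: (safe_extends sf ext).
- move=> z k k' /nbz[[zb zw fz bz nzb] [_ cwz]].
  case/seen_updE=> [[]|/(seen1 z k fz bz zw cwz)[_ ->]]; first by rewrite nzb.
  by case/seen_updE=> [[]|/(seen1 z k' fz bz zw cwz)[_ ->]]; rewrite ?nzb.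
- move=> z z' /nbz[_ [wz _]] /nbz[_ [wz' _]] czz'.
  exact: (avoid_sep wz wz' (gt2_in_avoid wcol2 czz')).
- move=> z z' /nbz[_ [_ cwz]] tz' fz'; apply/negP=> czz'.
  move: fz'; rewrite !uncolored_upd => /and3P[_ z'w _]; case/negP: (no_touched z').
  by rewrite /touched_comp tz' z'w (connect_trans cwz).
- move=> z p q /nbz[[zb _ _ _ _] [wz cwz]] czp; apply/negP=> bpq.
  have vpq : v \in [:: p; q].
    apply: cov (big_edge_extends ext bpq).
    exact: (connect_trans cwz (connect_extends ext czp)).
  have czv : connect (gt2_in (uncolored (upd f1 b m))) z v.
    move: vpq; rewrite !inE => /orP[] /eqP -> //.
    by apply: (connect_trans czp); apply: connect1; apply: big_edge_gt2.
  case/eqP: zb; apply: (avoid_sep wz wb).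
  apply: (connect_trans (gt2_in_avoid wcol2 czv)).
  by rewrite connect_avoidC.
Qed.

End Answer.

Lemma safe_answer f w c : safe f -> uncolored f w -> ~ complete (upd f w c) ->
  exists v m, legal e (upd f w c) v m /\ safe (upd (upd f w c) v m).
Proof.
move=> sf fw nc.
case: (boolP [exists b, [&& touched f b, b != w & connect (gt2_in (uncolored f)) w b]]).
  by case/existsP=> b tb; apply: answer_touched tb.
move/existsPn=> no.
case: (boolP [exists b, exists x, exists y, [&& new_touched f (upd f w c) b,
    connect (gt2_in (uncolored (upd f w c))) b x & big_edge (uncolored (upd f w c)) x y]]).
  case/existsP=> b /existsP[x /existsP[y /and3P[nb cbx bxy]]].
  exact: (answer_threat sf fw no nb cbx bxy).
move=> no2; have sf1 : safe (upd f w c).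
  apply: safe_after => // b x y nb cbx; apply: contraNN no2 => bxy.
  apply/existsP; exists b; apply/existsP; exists x; apply/existsP; exists y.
  by rewrite nb cbx bxy.
case: (boolP [exists v, uncolored (upd f w c) v]) => [/existsP[v fv]|/existsPn H].
  exact: safe_waiting_move sf1 fv.
case: nc => v /eqP fv; by case/negP: (H v).
Qed.

Lemma safe_not_blocked f : safe f -> ~ blocked e f.
Proof.
move=> [s1 _ _ _] [v [/eqP fv H]].
have S c : seen f v c by have [u [vu fu]] := H c; apply/seenP; exists u.
case: (boolP (big v)) => bv; last by have [k /negP[]] := small_free_color f bv.
have [k k0 _] := other_color ord0 ord0.
by case/eqP: k0; apply: (s1 v).
Qed.

(** Bob's move adds one colour to the at most one that a big vertex sees, so the position is not
    blocked before Alice answers, as [AW_alice] requires. *)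
Lemma safe_not_blocked_upd f w c : safe f -> uncolored f w -> ~ blocked e (upd f w c).
Proof.
move=> [s1 _ _ _] fw [v [/eqP fv H]].
have S k : seen (upd f w c) v k by have [u [vu fu]] := H k; apply/seenP; exists u.
case: (boolP (big v)) => bv; last by have [k /negP[]] := small_free_color (upd f w c) bv.
have fv' : uncolored f v by move: fv; rewrite -/(uncolored _ v) uncolored_upd => /andP[].
have [k kc _] := other_color c c; have [k' k'c k'k] := other_color c k.
have old j : j != c -> seen f v j.
  by move=> jc; case: (seen_updE (S j)) => // -[_ E]; rewrite E eqxx in jc.
by case/eqP: k'k; apply: (s1 v) => //; apply: old.
Qed.

Lemma safe_wins f : safe f -> AWin e 3 false f.
Proof.
have [n] := ubnP #|uncolored f|; elim: n f => // n IH f sz sf.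
case: (boolP [exists v, uncolored f v]) => [/existsP[v0 fv0]|/existsPn H]; last first.
  by apply: AW_done => v /eqP fv; case/negP: (H v).
apply: AW_bob; [by move/(_ v0); rewrite (eqP fv0)|exact: safe_not_blocked|].
move=> w c Lw; have fw : uncolored f w by apply/eqP; case: Lw.
case: (boolP [exists v, uncolored (upd f w c) v]) => [/existsP[v1 fv1]|/existsPn H]; last first.
  by apply: AW_done => v /eqP fv; case/negP: (H v).
have nc : ~ complete (upd f w c) by move/(_ v1); rewrite (eqP fv1).
have [v [m [L s2]]] := safe_answer sf fw nc.
apply: (@AW_alice _ _ _ _ v m nc (safe_not_blocked_upd sf fw) L); apply: IH => //.
rewrite ltnS in sz; apply: leq_trans sz; apply: proper_card; apply/properP; split.
  by apply/subsetP=> x; rewrite !unfold_in -/(uncolored _ _) !uncolored_upd => /and3P[].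
by exists w; rewrite !unfold_in -/(uncolored _ _) // !uncolored_upd eqxx andbF.
Qed.

Lemma good_start_alice_wins a : good_start a -> alice_wins e 3.
Proof.
move=> [gA gB]; have f0 v : uncolored [ffun=> None : option 'I_3] v by rewrite /uncolored ffunE.
apply: (@AW_alice _ _ _ _ a ord0).
- by move/(_ a); rewrite ffunE.
- by case=> v [_ /(_ ord0) [u []]]; rewrite ffunE.
- by split=> [|u]; rewrite ffunE.
apply: safe_wins; set f := upd _ _ _.
have fE v : uncolored f v = predC1 a v by rewrite uncolored_upd f0 andbT.
have gE x y : connect (gt2_in (uncolored f)) x y = connect (gt2_in (predC1 a)) x y.
  by apply: eq_connect => {}x {}y; rewrite /gt2_in /= -![_ != a]/(predC1 a _) -!fE.
have bE x y : big_edge (uncolored f) x y = big_edge (predC1 a) x y.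
  by rewrite /big_edge !fE.
have tE b : touched f b -> [/\ e a b, big b & b != a].
  case/and3P; rewrite fE => ba bb /existsP[u /andP[bu]].
  by rewrite fE /= negbK => /eqP E; split=> //; rewrite es -E.
split.
- move=> b c c' _ _ /seenP[u _ fu] /seenP[u' _ fu'].
  by move: fu fu'; rewrite !updE !ffunE; do 2![case: eqP => // _ [<-]].
- move=> b b' /tE[ab _ _] /tE[ab' _ _]; rewrite gE => cbb'.
  by apply: (avoid_sep ab ab'); apply: gt2_in_avoid cbb'; rewrite /= eqxx.
- by move=> b x y /tE[ab bb _]; rewrite gE bE; apply: gA.
- by move=> x y x' y'; rewrite !bE gE; apply: gB.
Qed.

End AliceStrategy.

End Forest.

(** * Trunks of the reduced graph *)

Section Trunks.
Variables (T : finType) (e : rel T) (C : {set T}).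
Hypothesis (simp : simple_graph e) (acyc : forest e).
Implicit Types (H : subg T) (x y : T).

Let es : symmetric e. Proof. by case: simp. Qed.
Let ei : irreflexive e. Proof. by case: simp. Qed.

Lemma sub_valid_edge H x y : sub_valid e H -> (x, y) \in H.2 ->
  [/\ x \in H.1, y \in H.1, e x y & (y, x) \in H.2].
Proof. by move=> /forallP/(_ x)/forallP/(_ y)/implyP V /V /and4P[]. Qed.

Lemma is_trunkP H : is_trunk e C H ->
  [/\ sub_valid e H, sub_connected H & colored_leaves C H].
Proof. by case/andP=> /and3P[]. Qed.

Lemma trunk_exists H : trunk_cand e C H ->
  exists H', [/\ is_trunk e C H', H.1 \subset H'.1 & H.2 \subset H'.2].
Proof.
move=> cH; pose P (K : subg T) := [&& trunk_cand e C K, H.1 \subset K.1 & H.2 \subset K.2].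
have PH : P H by rewrite /P cH !subxx.
have [K /and3P[cK s1 s2] maxK] := @arg_maxnP _ H P (fun K => #|K.1| + #|K.2|) PH.
exists K; split=> //; rewrite /is_trunk cK /=.
apply/forallP=> K'; apply/implyP=> /and3P[cK' k1 k2].
have PK' : P K' by rewrite /P cK' (subset_trans s1) ?(subset_trans s2).
have := maxK K' PK'; rewrite /=.
have l1 := subset_leq_card k1; have l2 := subset_leq_card k2 => le.
have e1 : #|K'.1| <= #|K.1|.
  by rewrite -(leq_add2r #|K'.2|) (leq_trans le) // leq_add2l.
have e2 : #|K'.2| <= #|K.2|.
  by rewrite -(leq_add2l #|K'.1|) (leq_trans le) // leq_add2r.
apply/eqP; case: K K' k1 k2 e1 e2 {cK s1 s2 maxK cK' PK' le l1 l2} => [A B] [A' B'] /= k1 k2 e1 e2.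
have /eqP -> : A == A' by rewrite eqEcard k1 e1.
by have /eqP -> : B == B' by rewrite eqEcard k2 e2.
Qed.

Lemma sub_rel_sym H : sub_valid e H -> symmetric (fun u v => (u, v) \in H.2).
Proof. by move=> V u v; apply/idP/idP=> /(sub_valid_edge V)[]. Qed.

(** By maximality: a missing edge at the uncoloured [x] could be added with [y] as a new leaf.
    Acyclicity keeps [y] out of the trunk, so a coloured [y] would get degree 1 and the other
    coloured vertices keep theirs. *)
Lemma trunk_edge H x y : is_trunk e C H -> x \in H.1 -> x \notin C -> e x y -> (x, y) \in H.2.
Proof.
move=> tH xH xC xy; have [V cn cl] := is_trunkP tH.
apply: contraT => nxy; have xny : x != y by apply: contraTneq xy => ->; rewrite ei.
have [n0 /forallP conn] := andP cn.
have connH p q : p \in H.1 -> q \in H.1 -> connect (fun u v => (u, v) \in H.2) p q.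
  by move=> pH qH; have /implyP/(_ pH)/forallP/(_ q)/implyP/(_ qH) := conn p.
have yH : y \notin H.1.
  apply/negP=> yH; have /connectP[p0 pth0 lst0] := connH _ _ yH xH.
  case/shortenP: pth0 lst0 => p pth un _ lst {p0}.
  case: p pth un lst => [|w p] pth un lst; first by rewrite lst eqxx in xny.
  have pe : path e y (w :: p).
    by apply: sub_path pth => u v /(sub_valid_edge V)[].
  have := mem_last w p; rewrite inE => /orP[/eqP E|xp].
    move: pth => /= /andP[yw _]; rewrite -E -[last w p]lst in yw.
    by have [_ _ _] := sub_valid_edge V yw; rewrite (negbTE nxy).
  by have := chord acyc pe un xp; rewrite -[last w p]lst xy.
pose K : subg T := (y |: H.1, [set (x, y); (y, x)] :|: H.2).
have sub2 : H.2 \subset K.2 by apply: subsetUr.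
have KE p q : ((p, q) \in K.2) = [|| (p == x) && (q == y), (p == y) && (q == x) | (p, q) \in H.2].
  by rewrite !inE !xpair_eqE orbA.
have VK : sub_valid e K.
  apply/forallP=> p; apply/forallP=> q; apply/implyP; rewrite KE.
  case/or3P=> [/andP[/eqP-> /eqP->]|/andP[/eqP-> /eqP->]|pq].
  - by rewrite KE !inE !eqxx xH xy /= !orbT.
  - by rewrite KE !inE !eqxx xH es xy /= !orbT.
  have [pH qH pq' qp] := sub_valid_edge V pq.
  by rewrite KE !inE pH qH pq' qp !orbT.
have symK := sub_rel_sym VK.
have cK p : p \in K.1 -> connect (fun u v => (u, v) \in K.2) x p.
  rewrite !inE => /orP[/eqP ->|pH]; first by apply: connect1; rewrite KE !eqxx.
  apply: connect_sub (connH _ _ xH pH) => u v uv.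
  by apply: connect1; apply: (subsetP sub2).
have := forallP (andP tH).2 K; rewrite subsetUr sub2 !andbT => /implyP maxK.
suff /maxK/eqP E : trunk_cand e C K by rewrite -E KE !eqxx in nxy.
apply/and3P; split=> //.
  apply/andP; split; first by apply/set0Pn; exists y; rewrite !inE eqxx.
  apply/forallP=> p; apply/implyP=> pK; apply/forallP=> q; apply/implyP=> qK.
  apply: connect_trans (cK q qK).
  by rewrite (sym_connect_sym symK); apply: cK.
apply/forallP=> p; apply/implyP=> pK; apply/implyP=> pC.
have px : p != x by apply: contraTneq pC => ->.
move: pK; rewrite !inE => /orP[/eqP py|pH].
  rewrite py /subdeg; suff -> : [set q | (y, q) \in K.2] = [set x] by rewrite cards1.
  apply/setP=> q; rewrite [in LHS]inE KE !inE eqxx (eq_sym y x) (negbTE xny) /=.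
  case: eqP => //= _; apply/negP=> /(sub_valid_edge V)[yH'].
  by rewrite yH' in yH.
have py : p != y by apply: contraTneq pH => ->.
have /implyP/(_ pH)/implyP/(_ pC) := forallP cl p.
by rewrite /subdeg; congr (_ == _); apply: eq_card => q; rewrite !inE !xpair_eqE (negbTE px) (negbTE py).
Qed.

Lemma trunk_cand1 x : x \notin C -> trunk_cand e C ([set x], set0).
Proof.
move=> xC; apply/and3P; split.
- by apply/forallP=> p; apply/forallP=> q; rewrite inE.
- apply/andP; split; first by apply/set0Pn; exists x; rewrite inE.
  apply/forallP=> p; apply/implyP; rewrite inE => /eqP ->.
  by apply/forallP=> q; apply/implyP; rewrite inE => /eqP ->.
- by apply/forallP=> p; apply/implyP; rewrite inE => /eqP ->; rewrite (negbTE xC).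
Qed.

(** Both ends of a single edge are leaves, so they may be coloured; this is the seed of a trunk
    through an edge at [a]. *)
Lemma trunk_cand2 x y : e x y -> trunk_cand e C ([set x; y], [set (x, y); (y, x)]).
Proof.
move=> xy; have xny : x != y by apply: contraTneq xy => ->; rewrite ei.
have E p q : ((p, q) \in [set (x, y); (y, x)]) = (p == x) && (q == y) || (p == y) && (q == x).
  by rewrite !inE !xpair_eqE.
apply/and3P; split.
- apply/forallP=> p; apply/forallP=> q; apply/implyP; rewrite E.
  by case/orP=> /andP[/eqP-> /eqP->]; rewrite E !inE !eqxx !orbT ?xy // es xy.
- apply/andP; split; first by apply/set0Pn; exists x; rewrite !inE eqxx.
  apply/forallP=> p; apply/implyP=> pin; apply/forallP=> q; apply/implyP=> qin.
  move: pin qin; rewrite !inE => /orP[]/eqP-> /orP[]/eqP-> //.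
    by apply: connect1; rewrite E !eqxx.
  by apply: connect1; rewrite E !eqxx orbT.
- apply/forallP=> p; apply/implyP; rewrite !inE => pin; apply/implyP=> _.
  rewrite /subdeg.
  case/orP: pin => /eqP->.
    suff -> : [set q | (x, q) \in [set (x, y); (y, x)]] = [set y] by rewrite cards1.
    by apply/setP=> q; rewrite [in LHS]inE E inE eqxx (negbTE xny) orbF.
  suff -> : [set q | (y, q) \in [set (x, y); (y, x)]] = [set x] by rewrite cards1.
  by apply/setP=> q; rewrite [in LHS]inE E inE eqxx eq_sym (negbTE xny).
Qed.

End Trunks.

(** * Degrees and paths in the reduced graph *)

Section ReducedGraph.
Variables (T : finType) (e : rel T) (C : {set T}).
Hypothesis (simp : simple_graph e) (acyc : forest e).
Implicit Types (H : subg T) (x y : T) (X Y : RV e C).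

Let ei : irreflexive e. Proof. by case: simp. Qed.

Lemma RV_trunk X : is_trunk e C (val X).1.
Proof. by have /andP[] := valP X. Qed.

Lemma RV_mem X : (val X).2 \in (val X).1.1.
Proof. by have /andP[] := valP X. Qed.

Lemma RV_exists H x : is_trunk e C H -> x \in H.1 -> exists X, val X = (H, x).
Proof.
move=> tH xH; have HP : is_trunk e C (H, x).1 && ((H, x).2 \in (H, x).1.1) by rewrite tH xH.
by exists (exist _ (H, x) HP).
Qed.

Lemma R_edgeP X Y : R_edge e C X Y ->
  [/\ (val Y).1 = (val X).1, ((val X).2, (val Y).2) \in (val X).1.2 & e (val X).2 (val Y).2].
Proof.
case/andP=> /eqP E xy; have [V _ _] := is_trunkP (RV_trunk X).
by have [_ _ ? _] := sub_valid_edge V xy; rewrite E; split; rewrite // -E.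
Qed.

Lemma R_simple : simple_graph (R_edge e C).
Proof.
split=> [X Y|X]; last by apply/negP=> /R_edgeP[_ _]; rewrite ei.
have sym Z W : R_edge e C Z W -> R_edge e C W Z.
  move=> ZW; have [E zw _] := R_edgeP ZW; have [V _ _] := is_trunkP (RV_trunk Z).
  by rewrite /R_edge E eqxx; have [] := sub_valid_edge V zw.
by apply/idP/idP; apply: sym.
Qed.

Lemma R'_edge_R X Y : R'_edge e C X Y -> R_edge e C X Y.
Proof. by case/andP. Qed.

Lemma R'_simple : simple_graph (R'_edge e C).
Proof.
split=> [|X]; first exact: (E_gt2_sym R_simple).
by apply/negP=> /R'_edge_R; rewrite R_simple.2.
Qed.

Lemma R_path_fst X p Y : path (R_edge e C) X p -> Y \in X :: p -> (val Y).1 = (val X).1.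
Proof.
elim: p X => [|Z p IH] X; first by rewrite inE => _ /eqP ->.
move=> /andP[/R_edgeP[E _ _] pth]; rewrite inE => /orP[/eqP -> //|YZ].
by rewrite (IH Z pth YZ).
Qed.

Lemma R_fst_inj X Y : (val X).1 = (val Y).1 -> (val X).2 = (val Y).2 -> X = Y.
Proof. by move=> E1 E2; apply: val_inj; apply/eqP; rewrite -pair_eqE /pair_eq E1 E2 !eqxx. Qed.

(** A path stays inside one trunk, where forgetting the trunk is injective, so a cycle would project
    to a cycle of the forest. *)
Lemma R'_forest : forest (R'_edge e C).
Proof.
move=> [|X s] //= us sz; apply/negP; rewrite rcons_path => /andP[pth lst].
have pR : path (R_edge e C) X s by apply: sub_path pth => ? ?; apply: R'_edge_R.
pose g (Z : RV e C) := (val Z).2.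
have un : uniq (map g (X :: s)).
  rewrite map_inj_in_uniq // => Y Z YX ZX E; apply: R_fst_inj => //.
  by rewrite (R_path_fst pR YX) (R_path_fst pR ZX).
have /negP[] : ~~ cycle e (map g (X :: s)).
  by apply: acyc => //; rewrite size_map.
rewrite [map _ _]/= [cycle _ _]/= rcons_path last_map; apply/andP; split.
  rewrite path_map; apply: sub_path pR => Y Z /R_edgeP[] //.
by have [] := R_edgeP (R'_edge_R lst).
Qed.

Lemma R_nbrs_sub X (A : {set T}) :
  (forall y, ((val X).2, y) \in (val X).1.2 -> y \in A) -> deg (R_edge e C) X <= #|A|.
Proof.
move=> sub; rewrite /deg -(card_in_imset (f := fun Z : RV e C => (val Z).2)).
  apply: subset_leq_card; apply/subsetP=> _ /imsetP[Y + ->].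
  by rewrite inE => /R_edgeP[_ xy _]; apply: sub.
move=> Y Z; rewrite !inE => /R_edgeP[EY _ _] /R_edgeP[EZ _ _] E.
by apply: R_fst_inj; rewrite // EY EZ.
Qed.

Lemma R_colored_deg X : (val X).2 \in C -> deg (R_edge e C) X <= 1.
Proof.
move=> xC; have [_ _ cl] := is_trunkP (RV_trunk X).
have /implyP/(_ (RV_mem X))/implyP/(_ xC)/eqP E := forallP cl (val X).2.
by rewrite -[X in _ <= X]E; apply: R_nbrs_sub => y; rewrite inE.
Qed.

Lemma R_big X : 2 < deg (R_edge e C) X -> big e (val X).2 /\ (val X).2 \notin C.
Proof.
move=> d; split; last by apply/negP=> /R_colored_deg; rewrite leqNgt (ltn_trans _ d).
apply: (leq_trans d); apply: R_nbrs_sub => y; rewrite inE.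
by have [V _ _] := is_trunkP (RV_trunk X); case/(sub_valid_edge V).
Qed.

Lemma R'_deg X : deg (R'_edge e C) X <= deg (R_edge e C) X.
Proof. by apply: subset_leq_card; apply/subsetP=> Y; rewrite !inE => /R'_edge_R. Qed.

Lemma R_nbr X y : (val X).2 \notin C -> e (val X).2 y ->
  exists2 Y, val Y = ((val X).1, y) & R_edge e C X Y.
Proof.
move=> xC xy; have inH := trunk_edge simp acyc (RV_trunk X) (RV_mem X) xC xy.
have [V _ _] := is_trunkP (RV_trunk X); have [_ yH _ _] := sub_valid_edge V inH.
have [Y EY] := RV_exists (RV_trunk X) yH.
by exists Y; rewrite // /R_edge EY /= eqxx.
Qed.

Lemma big_R X : (val X).2 \notin C -> big e (val X).2 -> 2 < deg (R_edge e C) X.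
Proof.
move=> xC bx; apply: (leq_trans bx).
apply: leq_trans (leq_imset_card (fun Z : RV e C => (val Z).2) _).
apply: subset_leq_card; apply/subsetP=> y; rewrite inE => xy.
have [Y EY XY] := R_nbr xC xy.
by apply/imsetP; exists Y; rewrite ?inE // EY.
Qed.

(** The reduction keeps every edge at a big vertex. Together with [R_big], being big means the same
    in the forest and in both derived graphs, for uncoloured copies. *)
Lemma big_R' X : (val X).2 \notin C -> big e (val X).2 -> 2 < deg (R'_edge e C) X.
Proof.
move=> xC bx; have d := big_R xC bx; apply: (leq_trans d).
apply: subset_leq_card; apply/subsetP=> Y; rewrite !inE => XY.
by rewrite /R'_edge /E_gt2 XY d.
Qed.

Lemma in_R_colored X : (X \in R_colored e C) = ((val X).2 \in C).
Proof. by rewrite inE. Qed.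

Lemma R'_edge_gt2 X Y : (val X).2 \notin C -> (val Y).2 \notin C -> R'_edge e C X Y ->
  gt2_in e [predC C] (val X).2 (val Y).2.
Proof.
move=> xC yC /andP[XY dd]; have [_ _ xy] := R_edgeP XY.
apply/and3P; split=> //; rewrite /E_gt2 xy /=.
by case/orP: dd => /R_big[b _]; rewrite -/(big e (val X).2) -/(big e (val Y).2) b ?orbT.
Qed.

Section InTrunk.
Variable K : subg (RV e C).
Hypothesis tK : is_trunk (R'_edge e C) (R_colored e C) K.

Lemma trunk_R'_edge X Y : (X, Y) \in K.2 -> [/\ X \in K.1, Y \in K.1 & R'_edge e C X Y].
Proof. by have [V _ _] := is_trunkP tK; move=> /(sub_valid_edge V)[]. Qed.

Lemma trunk_path X Y : X \in K.1 -> Y \in K.1 ->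
  exists p, [/\ path (fun U W => (U, W) \in K.2) X p, uniq (X :: p) & Y = last X p].
Proof.
move=> XK YK; have [_ /andP[_ /forallP conn] _] := is_trunkP tK.
have /implyP/(_ XK)/forallP/(_ Y)/implyP/(_ YK)/connectP[p0 pth0 lst0] := conn X.
by case/shortenP: pth0 lst0 => p pth un _ lst; exists p.
Qed.

Lemma trunk_path_mem X p Y : X \in K.1 -> path (fun U W => (U, W) \in K.2) X p ->
  Y \in X :: p -> Y \in K.1.
Proof.
elim: p X => [|Z p IH] X XK; first by rewrite inE => _ /eqP ->.
move=> /andP[/trunk_R'_edge[_ ZK _] pth]; rewrite inE => /orP[/eqP -> //|].
exact: IH.
Qed.

Lemma trunk_fst X Y : X \in K.1 -> Y \in K.1 -> (val X).1 = (val Y).1.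
Proof.
move=> XK YK; have [p [pth _ ->]] := trunk_path XK YK.
apply/esym/(@R_path_fst X p); last exact: mem_last.
by apply: sub_path pth => U W /trunk_R'_edge[_ _ /R'_edge_R].
Qed.

Lemma trunk_path_gt2 X p : path (fun U W => (U, W) \in K.2) X p ->
  all (fun Y => (val Y).2 \notin C) (X :: p) ->
  connect (gt2_in e [predC C]) (val X).2 (val (last X p)).2.
Proof.
elim: p X => [|Z p IH] X //= /andP[/trunk_R'_edge[_ _ XZ] pth] /and3P[xC zC pC].
apply: connect_trans (IH Z pth _); last by rewrite /= zC.
by apply: connect1; apply: R'_edge_gt2.
Qed.

Lemma trunk_R'_nbr X Y : X \in K.1 -> (val X).2 \notin C -> R'_edge e C X Y -> (X, Y) \in K.2.
Proof.
move=> XK xC XY; apply: (trunk_edge R'_simple R'_forest tK) => //.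
by rewrite in_R_colored.
Qed.

(** Condition (i) takes degrees in the reduced graph and (ii) in the trunk; at uncoloured vertices
    the two agree. *)
Lemma trunk_subdeg X : X \in K.1 -> (val X).2 \notin C -> subdeg K X = deg (R'_edge e C) X.
Proof.
move=> XK xC; apply: eq_card => Y; rewrite !inE; apply/idP/idP.
  by case/trunk_R'_edge.
exact: trunk_R'_nbr.
Qed.

Lemma trunk_subdeg_big X : X \in K.1 -> 2 < subdeg K X -> big e (val X).2 /\ (val X).2 \notin C.
Proof.
move=> XK d; apply: R_big; apply: (leq_trans d); apply: leq_trans (R'_deg X).
by apply: subset_leq_card; apply/subsetP=> Y; rewrite !inE => /trunk_R'_edge[].
Qed.

Lemma trunk_gt2_step X y : X \in K.1 -> gt2_in e [predC C] (val X).2 y ->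
  exists2 Y, val Y = ((val X).1, y) & (X, Y) \in K.2.
Proof.
move=> XK /and3P[/andP[xy dd] xC yC].
have [Y EY XY] := R_nbr xC xy; exists Y => //; apply: trunk_R'_nbr => //.
rewrite /R'_edge /E_gt2 XY /=; case/orP: dd => d.
  by rewrite big_R.
by rewrite (@big_R Y) ?EY ?orbT.
Qed.

(** Connections through uncoloured vertices lift to the trunk, because these vertices keep all their
    reduced edges in it. *)
Lemma trunk_gt2_connect X y : X \in K.1 -> connect (gt2_in e [predC C]) (val X).2 y ->
  exists2 Y, val Y = ((val X).1, y) & Y \in K.1.
Proof.
move=> XK /connectP[p pth ->]; elim: p X XK pth => [|z p IH] X XK.
  by exists X; rewrite // -surjective_pairing.
move=> /andP[xz pth]; have [Z EZ /trunk_R'_edge[_ ZK _]] := trunk_gt2_step XK xz.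
by have := IH Z ZK; rewrite EZ; apply.
Qed.

Lemma trunk_big_edge X x' y' : X \in K.1 -> connect (gt2_in e [predC C]) (val X).2 x' ->
  big_edge e [predC C] x' y' -> exists Y Z, [/\ val Y = ((val X).1, x'),
    val Z = ((val X).1, y'), (Y, Z) \in K.2, E_ggt2 (R'_edge e C) Y Z &
    2 < subdeg K Y /\ 2 < subdeg K Z].
Proof.
move=> XK cx bxy; have /and5P[xy bx by_ xC yC] := bxy.
have [Y EY YK] := trunk_gt2_connect XK cx.
have := @trunk_gt2_step Y y' YK; rewrite EY.
case=> [|Z EZ YZ]; first exact: big_edge_gt2.
have [_ ZK YZ'] := trunk_R'_edge YZ.
have [bY nY] : big e (val Y).2 /\ (val Y).2 \notin C by rewrite EY.
have [bZ nZ] : big e (val Z).2 /\ (val Z).2 \notin C by rewrite EZ.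
have [dY dZ] : 2 < deg (R'_edge e C) Y /\ 2 < deg (R'_edge e C) Z.
  by split; apply: big_R'.
exists Y, Z; split=> //; first by rewrite /E_ggt2 YZ' dY dZ.
by rewrite !trunk_subdeg.
Qed.

End InTrunk.
End ReducedGraph.

Definition trunks_good (T : finType) (e : rel T) (a : T) : Prop :=
  forall H : subg (RV e [set a]),
    is_trunk (R'_edge e [set a]) (R_colored e [set a]) H ->
    ( #|H.1 :&: R_colored e [set a]| = 1 /\
      (forall x y, (x, y) \in H.2 -> ~~ E_ggt2 (R'_edge e [set a]) x y) )
    \/
    ( H.1 :&: R_colored e [set a] = set0 /\
      exists2 v, v \in H.1 &
        forall x y, (x, y) \in H.2 -> 2 < subdeg H x -> 2 < subdeg H y ->
          v = x \/ v = y ).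

(** * Equivalence of the trunk condition and good starts *)

Section Bridge.
Variables (T : finType) (e : rel T) (a : T).
Hypothesis (simp : simple_graph e) (acyc : forest e).
Let C := [set a].

Let es : symmetric e. Proof. by case: simp. Qed.

Let predCE x : [predC C] x = predC1 a x.
Proof. by rewrite /= inE. Qed.

Let notinC x : (x \notin C) = (x != a).
Proof. by rewrite inE. Qed.

Let connectCE x y : connect (gt2_in e [predC C]) x y = connect (gt2_in e (predC1 a)) x y.
Proof. by apply: eq_connect => {}x {}y; rewrite /gt2_in /= !notinC. Qed.

Let big_edgeCE x y : big_edge e [predC C] x y = big_edge e (predC1 a) x y.
Proof. by rewrite /big_edge /= !notinC. Qed.

Lemma trunks_good_start : trunks_good e a -> good_start e a.
Proof.
move=> good; split=> [b x y ab bb cbx|x y x' y' bxy bxy' cxx'].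
  apply/negP=> bxy; have ba : b != a by rewrite eq_sym (adj_neq simp).
  (* The edge [a] [b] is lifted to a trunk of the forest and then to a trunk of the reduced graph.
     The latter contains a coloured copy, so only (i) can hold for it. *)
  have [H1 [tH1 /subsetP s1 /subsetP s2]] := trunk_exists (trunk_cand2 C simp ab).
  have [aH bH] : a \in H1.1 /\ b \in H1.1 by split; apply: s1; rewrite !inE eqxx ?orbT.
  have [Xa EXa] := RV_exists tH1 aH; have [Xb EXb] := RV_exists tH1 bH.
  have Xab : R'_edge e C Xa Xb.
    rewrite /R'_edge /E_gt2 /R_edge EXa EXb /= eqxx s2 ?inE ?eqxx //=.
    by rewrite (@big_R _ _ _ simp acyc Xb) ?EXb ?orbT // notinC.
  have [K [tK /subsetP k1 _]] :=
    trunk_exists (trunk_cand2 (R_colored e C) (R'_simple C simp) Xab).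
  have [aK bK] : Xa \in K.1 /\ Xb \in K.1 by split; apply: k1; rewrite !inE eqxx ?orbT.
  have := @trunk_big_edge _ _ _ simp acyc K tK Xb x y bK.
  rewrite EXb connectCE big_edgeCE => /(_ cbx bxy)[Y [Z [EY EZ YZ gYZ _]]].
  case: (good K tK) => [[_ /(_ Y Z YZ)]|[E _]]; first by rewrite gYZ.
  by have := in_set0 Xa; rewrite -E !inE aK EXa eqxx.
have xC : x \notin C by rewrite notinC; case/and5P: bxy.
have [H1 [tH1 /subsetP s1 _]] := trunk_exists (trunk_cand1 e xC).
have xH : x \in H1.1 by apply: s1; rewrite inE.
have [X EX] := RV_exists tH1 xH.
have XC : X \notin R_colored e C by rewrite in_R_colored EX.
have [K [tK /subsetP k1 _]] := trunk_exists (trunk_cand1 (R'_edge e C) XC).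
have XK : X \in K.1 by apply: k1; rewrite inE.
have := @trunk_big_edge _ _ _ simp acyc K tK X x y XK.
rewrite EX connectCE big_edgeCE => /(_ (connect0 _ _) bxy)[Y [Z [EY EZ YZ gYZ [dY dZ]]]].
have := @trunk_big_edge _ _ _ simp acyc K tK X x' y' XK.
rewrite EX connectCE big_edgeCE => /(_ cxx' bxy')[Y' [Z' [EY' EZ' YZ' _ [dY' dZ']]]].
case: (good K tK) => [[_ /(_ Y Z YZ)]|[_ [v _ cov]]]; first by rewrite gYZ.
have snd U W : U = W -> (val U).2 = (val W).2 by move=> ->.
by rewrite !inE; case: (cov _ _ YZ dY dZ) => /snd; case: (cov _ _ YZ' dY' dZ') => /snd;
  rewrite ?EY ?EZ ?EY' ?EZ' /= => -> ->; rewrite eqxx ?orbT.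
Qed.

Lemma good_start_trunks : good_start e a -> trunks_good e a.
Proof.
move=> [gA gB] K tK; have [V cn cl] := is_trunkP tK.
case: (set_0Vmem (K.1 :&: R_colored e C)) => [E0|[Xa]].
  right; split=> //.
  have nC X : X \in K.1 -> (val X).2 \notin C.
    move=> XK; apply/negP=> xC; have := in_set0 X; rewrite -E0 inE XK in_R_colored xC.
    by [].
  case: (boolP [exists X, exists Y, [&& (X, Y) \in K.2, 2 < subdeg K X & 2 < subdeg K Y]]).
    case/existsP=> X /existsP[Y /and3P[XY dX dY]].
    have edge U W : (U, W) \in K.2 -> 2 < subdeg K U -> 2 < subdeg K W ->
        [/\ U \in K.1, W \in K.1 & big_edge e (predC1 a) (val U).2 (val W).2].
      move=> UW dU dW; have [UK WK UW'] := trunk_R'_edge tK UW.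
      have [bU uC] := trunk_subdeg_big tK UK dU; have [bW wC] := trunk_subdeg_big tK WK dW.
      have [_ _ uw] := R_edgeP (R'_edge_R UW').
      by rewrite -big_edgeCE /big_edge uw bU bW /= uC wC.
    have [XK YK bxy] := edge _ _ XY dX dY.
    have [v vxy cov] := star_center simp acyc gB bxy.
    have [W WK EW] : exists2 W, W \in K.1 & (val W).2 = v.
      by move: vxy; rewrite !inE => /orP[] /eqP ->; [exists X|exists Y].
    exists W => // P Q PQ dP dQ; have [PK QK bpq] := edge _ _ PQ dP dQ.
    have [p [pth un lst]] := trunk_path tK XK PK.
    have cxp : connect (gt2_in e (predC1 a)) (val X).2 (val P).2.
      rewrite -connectCE lst; apply: (trunk_path_gt2 tK pth).
      by apply/allP=> U /(trunk_path_mem tK XK pth)/nC.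
    have := cov _ _ cxp bpq; rewrite !inE => /orP[] /eqP E; [left|right].
      by apply: R_fst_inj; [apply: (trunk_fst tK)|rewrite EW].
    by apply: R_fst_inj; [apply: (trunk_fst tK)|rewrite EW].
  move=> no; have /andP[/set0Pn[W WK] _] := cn.
  exists W => // P Q PQ dP dQ; case/negP: no.
  by apply/existsP; exists P; apply/existsP; exists Q; rewrite PQ dP.
case/setIP=> aK; rewrite in_R_colored => /set1P Ea; left.
(* All vertices of [K] come from one trunk of the forest, so two copies of [a] in [K] coincide. *)
have uniqa Z : Z \in K.1 -> (val Z).2 = a -> Z = Xa.
  by move=> ZK Ez; apply: R_fst_inj; [apply: (trunk_fst tK)|rewrite Ez].
split.
  suff -> : K.1 :&: R_colored e C = [set Xa] by rewrite cards1.
  apply/setP=> Z; rewrite in_set1; apply/setIP/eqP=> [[ZK]|->]; rewrite in_R_colored.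
    by move/set1P; apply: uniqa.
  by rewrite Ea set11.
move=> X Y XY; apply/negP=> /and3P[XY' dX dY].
have [XK YK _] := trunk_R'_edge tK XY.
have [bX xC] := R_big (leq_trans dX (R'_deg X)).
have [bY yC] := R_big (leq_trans dY (R'_deg Y)).
have [_ _ xy] := R_edgeP (R'_edge_R XY').
(* The path leaves the coloured leaf through its big neighbour [B], to which the first clause
   applies; the rest of the path avoids [a]. *)
have [[|B p] [pth un lst]] := trunk_path tK aK XK.
  by rewrite lst /= Ea notinC eqxx in xC.
have /andP[aB pthB] := pth; have [_ BK aB'] := trunk_R'_edge tK aB.
have /andP[aBR dd] := aB'; have [_ _ ab] := R_edgeP aBR.
have bB : big e (val B).2.
  case/orP: dd => [d|/(R_big)[]] //.
  by have [_] := R_big d; rewrite Ea notinC eqxx.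
rewrite Ea in ab.
have cbx : connect (gt2_in e (predC1 a)) (val B).2 (val X).2.
  rewrite -connectCE lst; apply: (trunk_path_gt2 tK pthB).
  apply/allP=> U Up; rewrite notinC; apply/eqP=> Eu.
  have E := uniqa U (trunk_path_mem tK BK pthB Up) Eu.
  by rewrite -E cons_uniq Up in un.
have := gA _ _ (val Y).2 ab bB cbx.
by rewrite -big_edgeCE /big_edge xy bX bY /= xC yC.
Qed.

End Bridge.

Theorem theorem7p3 (T : finType) (e : rel T) (n : nat) :
  simple_graph e -> forest e -> (0 < #|T|) ->
  (forall v : T, deg e v <> 3) ->
  is_game_chromatic_number e n ->
  (n < 4 <->
   exists a : T,
     forall H : subg (RV e [set a]),
       is_trunk (R'_edge e [set a]) (R_colored e [set a]) H ->
       ( #|H.1 :&: R_colored e [set a]| = 1 /\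
         (forall x y, (x, y) \in H.2 ->
            ~~ E_ggt2 (R'_edge e [set a]) x y) )
       \/
       ( H.1 :&: R_colored e [set a] = set0 /\
         exists2 v, v \in H.1 &
           forall x y, (x, y) \in H.2 -> 2 < subdeg H x -> 2 < subdeg H y ->
             v = x \/ v = y )).
Proof.
move=> simp acyc T0 deg3 [win least]; split=> [n4|[a good]].
  have [a ga] := alice_wins_good_start simp acyc deg3 T0 n4 win.
  by exists a; apply: good_start_trunks.
rewrite ltnNge; apply/negP=> n4; apply: (least 3 n4).
exact: (good_start_alice_wins simp acyc (trunks_good_start simp acyc good)).
Qed.
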